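(* Let $(M^{2n+1},g)$ be a Riemannian manifold equipped with a normal almost contact metric structure $(\theta,\xi,\eta)$. The first harmonic section equation $[\bar\nabla^*\bar\nabla\bar J,\bar J]=0$ for this structure can be written (i.e. is equivalent to) $$\sum_{i=1}^{2n}[\bar R(F_i,\bar JF_i),\bar J]=-2\bar\nabla_{\bar\delta\bar J}\bar J,$$ where $\{F_i\}_{i=1,\dots,2n}$ is an orthonormal frame on the horizontal sub-bundle $\mathcal F$.
   Context: An almost contact metric structure $(\theta,\xi,\eta)$ on $(M^{2n+1},g)$: $\theta\in\mathrm{End}(TM)$, $\xi$ a vector field, $\eta$ a 1-form, with $\eta(\xi)=1$, $\theta^2=-\mathrm{Id}+\eta\otimes\xi$ and $g(\theta X,\theta Y)=g(X,Y)-\eta(X)\eta(Y)$. It is normal if the almost complex structure $\tilde J(X+f\partial_t)=\theta X-f\xi+\eta(X)\partial_t$ on $M\times\mathbb R$ is integrable. $\nabla$ is the Levi-Civita connection; $\mathcal F=\xi^\perp$ is the horizontal (contact) sub-bundle; $\bar J=\theta|_{\mathcal F}$; $\bar\nabla$ is the connection on $\mathcal F$ obtained by orthogonally projecting $\nabla$ to $\mathcal F$; $\bar R$ is the curvature of $(\mathcal F,\bar\nabla)$, with sign convention $R(X,Y)=[\nabla_X,\nabla_Y]-\nabla_{[X,Y]}$. $\bar\nabla^*\bar\nabla\bar J=-\mathrm{trace}\,\bar\nabla^2\bar J$ (trace over $TM$, using $\nabla$ on $TM$). $\bar\delta\bar J=\sum_{i=1}^{2n}(\bar\nabla_{F_i}\bar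 J)(F_i)$. *)

(* Defs.v *)
From HB Require Import structures.
From mathcomp Require Import all_boot all_order all_algebra.
From mathcomp Require Import all_classical all_reals all_analysis.
From mathcomp Require Import ring.

Set Implicit Arguments.
Unset Strict Implicit.
Unset Printing Implicit Defensive.

Import Order.TTheory GRing.Theory Num.Theory.
Import numFieldNormedType.Exports.

Local Open Scope classical_set_scope.
Local Open Scope ring_scope.

(* On a neighbourhood of [x], all iterated directional derivatives of [f] of
   order at most [k] exist and are continuous. *)
Fixpoint Ck_at (R : realType) (V : normedModType R) (k : nat)
    (f : V -> R) (x : V) {struct k} : Prop :=
  match k with
  | 0 => \forall y \near x, {for y, continuous f}
  | k'.+1 => (\forall y \near x, {for y, continuous f}) /\
      forall v : V, (\forall y \near x, derivable f y v) /\
                    Ck_at k' (fun y => 'D_v f y) x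
  end.

Definition smooth_at (R : realType) (V : normedModType R)
    (f : V -> R) (x : V) : Prop :=
  forall k, Ck_at k f x.

Section SmoothCalculus.
Variable R : realType.
Implicit Types V W : normedModType R.

Lemma Ck_at_cont V k (f : V -> R) x :
  Ck_at k f x -> \forall y \near x, {for y, continuous f}.
Proof. by case: k => [//|k] []. Qed.

Lemma Ck_at_le V k (f : V -> R) x : Ck_at k.+1 f x -> Ck_at k f x.
Proof.
elim: k f => [|k IH] f; first by case.
case=> fc fd; split=> // v; have [fv /IH fk] := fd v; by split.
Qed.

Lemma Ck_at_near_eq V k (f g : V -> R) x :
  (\near x, f x = g x) -> Ck_at k f x -> Ck_at k g x.
Proof.
elim: k f g => [|k IH] f g fg.
  move=> /= fc; near=> y.
  have fgy : \near y, f y = g y by near: y; exact: near_join.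
  have fy : f y = g y by exact: nbhs_singleton fgy.
  have fcy : {for y, continuous f} by near: y.
  by rewrite /prop_for /continuous_at -fy; apply: cvg_trans fcy; exact: near_eq_cvg.
move=> [fc fd]; split.
  near=> y.
  have fgy : \near y, f y = g y by near: y; exact: near_join.
  have fy : f y = g y by exact: nbhs_singleton fgy.
  have fcy : {for y, continuous f} by near: y.
  by rewrite /prop_for /continuous_at -fy; apply: cvg_trans fcy; exact: near_eq_cvg.
move=> v; have [fv fk] := fd v; split.
  near=> y; apply: (@near_eq_derivable _ _ _ f); last by near: y.
  by near: y; exact: near_join.
apply: IH fk; near=> y; apply: near_eq_derive.
by near: y; exact: near_join.
Unshelve. all: by end_near. Qed.

Lemma Ck_at_cst V k (a : R) (x : V) : Ck_at k (fun=> a) x.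
Proof.
elim: k a => [|k IH] a /=; first by near=> y; exact: cst_continuous.
split; first by near=> y; exact: cst_continuous.
move=> v; split; first by near=> y; exact: derivable_cst.
by apply: Ck_at_near_eq (IH 0); near=> y; rewrite derive_cst.
Unshelve. all: by end_near. Qed.

Lemma Ck_atD V k (f g : V -> R) x :
  Ck_at k f x -> Ck_at k g x -> Ck_at k (fun y => f y + g y) x.
Proof.
elim: k f g => [|k IH] f g.
  by move=> fc gc; apply: filterS2 fc gc => y; exact: continuousD.
move=> [fc fd] [gc gd]; split.
  by apply: filterS2 fc gc => y; exact: continuousD.
move=> v; have [fv fk] := fd v; have [gv gk] := gd v; split.
  by apply: filterS2 fv gv => y fy gy; exact: (derivableD fy gy).
apply: Ck_at_near_eq (IH _ _ fk gk).
by apply: filterS2 fv gv => y fy gy; exact: esym (deriveD fy gy).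
Qed.

Lemma Ck_atM V k (f g : V -> R) x :
  Ck_at k f x -> Ck_at k g x -> Ck_at k (fun y => f y * g y) x.
Proof.
elim: k f g => [|k IH] f g.
  by move=> fc gc; apply: filterS2 fc gc => y; exact: continuousM.
move=> fC gC; have fk := Ck_at_le fC; have gk := Ck_at_le gC.
move: fC gC => [fc fd] [gc gd]; split.
  by apply: filterS2 fc gc => y; exact: continuousM.
move=> v; have [fv fk'] := fd v; have [gv gk'] := gd v; split.
  by apply: filterS2 fv gv => y fy gy; exact: (derivableM fy gy).
apply: Ck_at_near_eq (Ck_atD (IH _ _ fk gk') (IH _ _ gk fk')).
by apply: filterS2 fv gv => y fy gy; exact: esym (deriveM fy gy).
Qed.

Lemma Ck_at_comp_affine V W k (f : W -> R) (a : V -> W) (L : V -> W) x :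
  continuous a -> (forall y (h : R) v, a (h *: v + y) = h *: L v + a y) ->
  Ck_at k f (a x) -> Ck_at k (fun y => f (a y)) x.
Proof.
move=> ac aL.
have contc g : (\forall z \near a x, {for z, continuous g}) ->
    \forall y \near x, {for y, continuous (fun y => (g (a y) : R))}.
  move=> gc; have gc' : \forall y \near x, {for a y, continuous g}
    by have acx := ac x; exact: acx gc.
  near=> y; apply: (@continuous_comp _ _ _ a g); first exact: ac.
  by near: y.
have diffE g y v : (fun h : R => h^-1 *: (((fun z => (g (a z) : R)) \o shift y)
      (h *: v) - g (a y))) =
    (fun h : R => h^-1 *: ((g \o shift (a y)) (h *: L v) - g (a y))).
  by apply/funext => h /=; rewrite aL.
elim: k f => [|k IH] f; first exact: contc.
move=> [fc fd]; split; first exact: contc.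
move=> v; have [fv fk] := fd (L v); split.
  have fv' : \forall y \near x, derivable f (a y) (L v) by have acx := ac x; exact: acx fv.
  by near=> y; rewrite /derivable diffE; near: y.
by apply: Ck_at_near_eq (IH _ fk); near=> y; rewrite /derive diffE.
Unshelve. all: by end_near. Qed.

End SmoothCalculus.

Section Manifold.
Variables (R : realType) (M : topologicalType) (m : nat).

(* [param c] inverts [coord c] on [dom c]; outside [dom c] (resp. outside the
   image of [dom c]) the values of [coord c] (resp. [param c]) are junk. *)
Record chart := Chart {
  dom : set M;
  coord : M -> 'rV[R]_m;
  param : 'rV[R]_m -> M }.

Record smooth_manifold (A : set chart) : Prop := SmoothManifold {
  manifold_hausdorff : hausdorff_space M;
  manifold_countable : @second_countable M;
  manifold_cover : forall p, exists2 c, A c & dom c p;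
  chart_dom_open : forall c, A c -> open (dom c);
  chart_img_open : forall c, A c -> open (coord c @` dom c);
  chart_coordK : forall c, A c -> forall p, dom c p -> param c (coord c p) = p;
  chart_coord_continuous : forall c, A c -> forall p, dom c p ->
    {for p, continuous (coord c)};
  chart_param_continuous : forall c, A c -> forall p, dom c p ->
    {for coord c p, continuous (param c)};
  chart_transition : forall c c', A c -> A c' -> forall p,
    dom c p -> dom c' p -> forall j,
    smooth_at (fun x => coord c' (param c x) 0 j) (coord c p) }.

Definition smooth_fun (A : set chart) (f : M -> R) : Prop :=
  forall c, A c -> forall p, dom c p ->
  smooth_at (fun x => f (param c x)) (coord c p).

Variable A : set chart.

Definition smooth_fun_pred : {pred M -> R} := fun f => `[< smooth_fun A f >].

Lemma smooth_fun_subring : subring_closed smooth_fun_pred.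
Proof.
split.
- by apply/asboolP => c _ p _ k; exact: Ck_at_cst.
- move=> f g /asboolP fs /asboolP gs; apply/asboolP => c Ac p cp k.
  apply: Ck_at_near_eq (Ck_atD (fs c Ac p cp k)
    (Ck_atM (Ck_at_cst k (-1) (coord c p)) (gs c Ac p cp k))).
  by near=> y; rewrite mulN1r.
- move=> f g /asboolP fs /asboolP gs; apply/asboolP => c Ac p cp k.
  exact: Ck_atM (fs c Ac p cp k) (gs c Ac p cp k).
Unshelve. all: by end_near. Qed.

(* The ring C^oo(M). *)
Record cinf := Cinf {
  cinf_val :> M -> R;
  cinf_smooth : cinf_val \in smooth_fun_pred }.

HB.instance Definition _ := [isSub for cinf_val].
HB.instance Definition _ := [Choice of cinf by <:].
HB.instance Definition _ := GRing.SubChoice_isSubComPzRing.Build _ _ cinf smooth_fun_subring.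

Lemma cinf_cst_subproof (a : R) : (fun=> a) \in smooth_fun_pred.
Proof. by apply/asboolP => c _ p _ k; exact: Ck_at_cst. Qed.

Definition cinf_cst (a : R) : cinf := Cinf (cinf_cst_subproof a).

(* R-linear derivations of C^oo(M). *)
Definition derivation (D : cinf -> cinf) : Prop :=
  (forall (a : R) f h, D (cinf_cst a * f + h) = cinf_cst a * D f + D h) /\
  (forall f h, D (f * h) = D f * h + f * D h).

Definition derivation_pred : {pred cinf -> cinf} :=
  fun D => `[< derivation D >].

Lemma derivation_zmod : zmod_closed derivation_pred.
Proof.
split.
  by apply/asboolP; split=> *; rewrite ?(mulr0, mul0r, addr0).
move=> D E /asboolP[D1 D2] /asboolP[E1 E2]; apply/asboolP; split=> [a|] f h.
  change (D (cinf_cst a * f + h) - E (cinf_cst a * f + h) =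
    cinf_cst a * (D f - E f) + (D h - E h)).
  by rewrite D1 E1 mulrBr opprD addrACA.
change (D (f * h) - E (f * h) = (D f - E f) * h + f * (D h - E h)).
by rewrite D2 E2 mulrBr mulrBl opprD addrACA.
Qed.

HB.instance Definition _ :=
  GRing.isZmodClosed.Build (cinf -> cinf) derivation_pred derivation_zmod.

(* Smooth vector fields, as derivations of C^oo(M): the module X(M). *)
Record vf := Vf {
  vf_val :> cinf -> cinf;
  vf_derivation : vf_val \in derivation_pred }.

HB.instance Definition _ := [isSub for vf_val].
HB.instance Definition _ := [Choice of vf by <:].
HB.instance Definition _ := [SubChoice_isSubZmodule of vf by <:].

Lemma vf_ext (X Y : vf) : (forall f, X f = Y f) -> X = Y.
Proof. by move=> XY; apply/val_inj/funext. Qed.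

Lemma vf_scale_subproof (f : cinf) (X : vf) :
  (fun h => f * X h) \in derivation_pred.
Proof.
have /asboolP[X1 X2] := vf_derivation X.
apply/asboolP; split=> [a|] h k; first by rewrite X1 mulrDr mulrCA.
by rewrite X2 mulrDr mulrA [f * (h * _)]mulrCA.
Qed.

Definition vf_scale (f : cinf) (X : vf) : vf := Vf (vf_scale_subproof f X).

Lemma vf_scaleA f h X : vf_scale f (vf_scale h X) = vf_scale (f * h) X.
Proof. by apply: vf_ext => k /=; rewrite mulrA. Qed.

Lemma vf_scale1 : left_id 1 vf_scale.
Proof. by move=> X; apply: vf_ext => k /=; rewrite mul1r. Qed.

Lemma vf_scaleDr : right_distributive vf_scale +%R.
Proof. by move=> f X Y; apply: vf_ext => k; rewrite /= /GRing.add /= mulrDr. Qed.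

Lemma vf_scaleDl X : {morph vf_scale^~ X : f h / f + h}.
Proof. by move=> f h; apply: vf_ext => k; rewrite /= mulrDl. Qed.

HB.instance Definition _ := GRing.Zmodule_isLmodule.Build cinf vf
  vf_scaleA vf_scale1 vf_scaleDr vf_scaleDl.

Lemma lie_subproof (X Y : vf) : (fun f => X (Y f) - Y (X f)) \in derivation_pred.
Proof.
have /asboolP[X1 X2] := vf_derivation X.
have /asboolP[Y1 Y2] := vf_derivation Y.
apply/asboolP; split=> [a|] f h.
  by rewrite X1 Y1 X1 Y1 mulrBr opprD addrACA.
have XD k l : X (k + l) = X k + X l.
  by have := X1 1 k l; rewrite (_ : cinf_cst 1 = 1) ?mul1r //; apply: val_inj.
have YD k l : Y (k + l) = Y k + Y l.
  by have := Y1 1 k l; rewrite (_ : cinf_cst 1 = 1) ?mul1r //; apply: val_inj.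
rewrite X2 Y2 XD YD !X2 !Y2.
ring.
Qed.

Definition lie (X Y : vf) : vf := Vf (lie_subproof X Y).

(* Equality of the tangent vectors X_p and Y_p. *)
Definition eq_at (p : M) (X Y : vf) : Prop := forall f, X f p = Y f p.

Definition nijenhuis (J : vf -> vf) (X Y : vf) : vf :=
  lie (J X) (J Y) - J (lie (J X) Y) - J (lie X (J Y)) + J (J (lie X Y)).

(* Tensor fields are encoded as C^oo(M)-multilinear maps on X(M). *)
Record riemannian_metric (g : vf -> vf -> cinf) : Prop := RiemannianMetric {
  metric_sym : forall X Y : vf, g X Y = g Y X;
  metric_linear : forall (f : cinf) (X Y Z : vf), g (f *: X + Y) Z = f * g X Z + g Y Z;
  metric_pos : forall (X : vf) (p : M), ~ eq_at p X 0 -> 0 < g X X p }.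

Record levi_civita (g : vf -> vf -> cinf) (nabla : vf -> vf -> vf) : Prop :=
  LeviCivita {
  connection_linear : forall (f : cinf) (X Y Z : vf),
    nabla (f *: X + Y) Z = f *: nabla X Z + nabla Y Z;
  connection_additive : forall X Y Z : vf, nabla X (Y + Z) = nabla X Y + nabla X Z;
  connection_leibniz : forall (f : cinf) (X Y : vf),
    nabla X (f *: Y) = X f *: Y + f *: nabla X Y;
  connection_metric : forall X Y Z : vf,
    X (g Y Z) = g (nabla X Y) Z + g Y (nabla X Z);
  connection_torsion_free : forall X Y : vf, nabla X Y - nabla Y X = lie X Y }.

Record almost_contact_metric (g : vf -> vf -> cinf)
    (theta : {linear vf -> vf}) (xi : vf) (eta : {scalar vf}) : Prop :=
  AlmostContactMetric {
  contact_eta_xi : eta xi = 1;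
  contact_theta_sq : forall X : vf, theta (theta X) = - X + (eta X : cinf) *: xi;
  contact_compatible : forall X Y : vf,
    g (theta X) (theta Y) = g X Y - (eta X : cinf) * eta Y }.

End Manifold.

Section Product.
Variables (R : realType) (M : topologicalType) (m : nat) (A : set (chart R M m)).

Definition prod_chart (c : chart R M m) : chart R (M * R)%type (m + 1) :=
  Chart [set q | dom c q.1]
    (fun q => row_mx (coord c q.1) (const_mx q.2))
    (fun v => (param c (lsubmx v), rsubmx v 0 0)).

(* The product atlas on M x R. *)
Definition prod_atlas : set (chart R (M * R)%type (m + 1)) := prod_chart @` A.

Lemma pullback_subproof (f : cinf A) :
  (fun q : M * R => f q.1) \in smooth_fun_pred prod_atlas.
Proof.
apply/asboolP => _ [c Ac <-] [p t] /= cp k.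
apply: (@Ck_at_comp_affine _ _ _ _ (fun x => f (param c x)) lsubmx lsubmx).
- exact: continuous_lsubmx.
- by move=> y h v; rewrite linearP.
- rewrite row_mxKl.
  by have /asboolP fs := cinf_smooth f; exact: fs.
Qed.

(* f o pi_1 *)
Definition pullback (f : cinf A) : cinf prod_atlas := Cinf (pullback_subproof f).

Lemma slice_subproof (F : cinf prod_atlas) (t : R) :
  (fun p : M => F (p, t)) \in smooth_fun_pred A.
Proof.
apply/asboolP => c Ac p cp k.
pose a (x : 'rV[R]_m) : 'rV[R]_(m + 1) := row_mx x (const_mx t).
pose L (x : 'rV[R]_m) : 'rV[R]_(m + 1) := row_mx x 0.
have /asboolP Fs := cinf_smooth F.
have Fk := Fs _ (ex_intro2 _ _ c Ac erefl) (p, t) cp k.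
have aE x : (param c (lsubmx (a x)), rsubmx (a x) 0 0) = (param c x, t).
  by rewrite row_mxKl row_mxKr mxE.
have : Ck_at k (fun x => F (param c (lsubmx (a x)), rsubmx (a x) 0 0)) (coord c p).
  apply: (Ck_at_comp_affine (L := L)) Fk.
  - move=> x B /nbhs_ballP[e /= e0 eB].
    apply/nbhs_ballP; exists e => //= y [_ xy]; apply: eB; split=> // i j.
    rewrite !mxE; case: splitP => l _; first exact: xy.
    by rewrite !mxE; exact: ballxx.
  - move=> y h v; rewrite /a /L scale_row_mx add_row_mx scaler0.
    by rewrite add0r.
by congr (Ck_at k _ _); apply/funext => x; rewrite aE.
Qed.

(* F(., t) *)
Definition slice (F : cinf prod_atlas) (t : R) : cinf A :=
  Cinf (slice_subproof F t).

(* [X'] is the vector field X on M x R, tangent to the slices M x {t}. *)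
Definition is_lift (X : vf A) (X' : vf prod_atlas) : Prop :=
  forall F p t, X' F (p, t) = X (slice F t) p.

(* [D] is the vector field d/dt on M x R. *)
Definition is_ddt (D : vf prod_atlas) : Prop :=
  forall (F : cinf prod_atlas) p t, D F (p, t) = derive1 (fun s : R => F (p, s)) t.

(* The vector fields [lift X] and [ddt] always exist and are determined by
   [is_lift] and [is_ddt]; [J] is determined by its values on the fields
   X + f d/dt, which generate the module X(M x R).  An almost complex structure
   is called integrable when its Nijenhuis tensor vanishes. *)
Definition normal (theta : {linear vf A -> vf A}) (xi : vf A)
    (eta : {scalar vf A}) : Prop :=
  exists (lift : vf A -> vf prod_atlas) (ddt : vf prod_atlas)
         (J : {linear vf prod_atlas -> vf prod_atlas}),
  [/\ forall X, is_lift X (lift X), is_ddt ddt,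
      forall (X : vf A) (f : cinf prod_atlas),
        J (lift X + f *: ddt) =
        lift (theta X) - f *: lift xi + pullback (eta X) *: ddt &
      forall V W, nijenhuis J V W = 0].

End Product.

Section HarmonicSection.
Variables (R : realType) (M : topologicalType) (m : nat) (A : set (chart R M m)).
Variables (g : vf A -> vf A -> cinf A) (nabla : vf A -> vf A -> vf A).
Variables (theta : {linear vf A -> vf A}) (xi : vf A).

(* Sections of the horizontal bundle F = xi^perp.  Bundle maps F -> F are
   represented by maps X(M) -> X(M), only to be evaluated on horizontal
   fields; in particular [theta] stands for its restriction to F. *)
Definition horizontal (Y : vf A) : Prop := g Y xi = 0.

(* Orthogonal projection onto F: for an almost contact metric structure, [xi]
   has unit length. *)
Definition hproj (X : vf A) : vf A := X - g X xi *: xi.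

Definition hnabla (X Y : vf A) : vf A := hproj (nabla X Y).

Definition hcurv (X Y Z : vf A) : vf A :=
  hnabla X (hnabla Y Z) - hnabla Y (hnabla X Z) - hnabla (lie X Y) Z.

(* The covariant derivative of a bundle map B : F -> F. *)
Definition hnabla_end (X : vf A) (B : vf A -> vf A) : vf A -> vf A :=
  fun Y => hnabla X (B Y) - B (hnabla X Y).

Definition hnabla2_end (X Y : vf A) (B : vf A -> vf A) : vf A -> vf A :=
  fun Z => hnabla_end X (hnabla_end Y B) Z - hnabla_end (nabla X Y) B Z.

Definition comm (B C : vf A -> vf A) : vf A -> vf A :=
  fun Y => B (C Y) - C (B Y).

(* [E] restricts over [U] to an orthonormal frame of the sub-bundle of TM whose
   sections are the fields satisfying [P].  Near each point, any local
   orthonormal frame is of this form, with globally defined [E]. *)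
Definition orthonormal_frame (P : vf A -> Prop) (U : set M) (k : nat)
    (E : 'I_k -> vf A) : Prop :=
  (forall i, P (E i)) /\
  forall p, U p ->
    (forall i j, g (E i) (E j) p = (i == j)%:R) /\
    (forall X, P X -> exists a : 'I_k -> R,
       forall f, X f p = \sum_i a i * E i f p).

Definition rough_laplacian (k : nat) (E : 'I_k -> vf A)
    (B : vf A -> vf A) : vf A -> vf A :=
  fun Y => - \sum_i hnabla2_end (E i) (E i) B Y.

(* [hnabla^* hnabla J, J] = 0, the trace being computed in local orthonormal
   frames of TM. *)
Definition first_harmonic_section_equation : Prop :=
  forall (U : set M) (E : 'I_m -> vf A), open U ->
  orthonormal_frame (fun=> True) U E ->
  forall Y p, horizontal Y -> U p ->
  eq_at p (comm (rough_laplacian E theta) theta Y) 0.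

Definition hdiv (k : nat) (F : 'I_k -> vf A) (B : vf A -> vf A) : vf A :=
  \sum_i hnabla_end (F i) B (F i).

End HarmonicSection.

(* Main.v *)
(* Write [S_X] for the covariant derivative of [theta] on the horizontal bundle
   and [T(X,Y)] for its second covariant derivative.  Normality says that
   [S_(theta X) = theta S_X] and [S_xi = 0] on horizontal fields, and that
   [nabla_xi xi = 0].  Differentiating the first relation gives
   [T(X,theta Y) = S_X S_Y + theta T(X,Y) - S_(S_X Y)], and differentiating
   [theta S_Y + S_Y theta = 0] gives
   [T(X,Y) theta + theta T(X,Y) = - S_X S_Y - S_Y S_X].  Tracing both and using
   the Ricci identity, the sum of the [[R(F_i,theta F_i),theta]] plus
   [2 S_(div theta)] equals [[nabla^* nabla theta, theta]], identically.

   Vector fields are only derivations of the ring of smooth functions, so two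
   facts need analysis.  That traces do not depend on the frame requires the
   values of tensors at a point to depend on the values of their arguments only;
   this is proved on a dense set, which is enough by continuity.  That [d/dt]
   commutes with the lifts to [M x R] requires Hadamard's lemma in [t]. *)

From HB Require Import structures.
Require Import Defs.
From mathcomp Require Import all_boot all_order all_algebra.
From mathcomp Require Import all_classical all_reals all_analysis.
From mathcomp Require Import ring lra.

Set Implicit Arguments.
Unset Strict Implicit.
Unset Printing Implicit Defensive.

Import Order.TTheory GRing.Theory Num.Theory.
Import numFieldNormedType.Exports.

Local Open Scope classical_set_scope.
Local Open Scope ring_scope.

(** * Bump functions *)

Section FlatFunction.
Variable R : realType.
Implicit Types (V : normedModType R) (t : R).

(** The two difference quotients are the same function of [h]. This brings the one-variable chain
    rule to directional derivatives. *)
Lemma is_derive_line V (f : V -> R) (y v : V) (s d : R) :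
  is_derive (s *: v + y) v f d <-> is_derive s 1 (fun r => f (r *: v + y)) d.
Proof.
have E : (fun h : R => h^-1 *: ((f \o shift (s *: v + y)) (h *: v) - f (s *: v + y)))
  = (fun h : R => h^-1 *: (((fun r => f (r *: v + y)) \o shift s) (h *: 1) - f (s *: v + y))).
  by apply/funext => h /=; rewrite addrA -scalerDl [h *: 1]mulr1.
by split=> -[D1 D2]; split;
  [rewrite /derivable -E|rewrite /derive -E|rewrite /derivable E|rewrite /derive E].
Qed.

(** For [n = 0] this is the classical function exp(-1/t), flat at 0. The powers of 1/t are those
    that differentiation produces, so that the family is stable under derivatives up to linear
    combination. *)
Definition flat (n : nat) (t : R) : R :=
  if 0 < t then t^-1 ^+ n * expR (- t^-1) else 0.

(** The exponential series gives x^(n+1) / (n+1)! <= exp x at x = 1/t. The factor [t] makes the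
    difference quotients at 0 tend to 0. *)
Lemma flat_le n t : 0 < t -> flat n t <= n.+1`!%:R * t.
Proof.
move=> t0; rewrite /flat t0.
have ti0 : 0 <= t^-1 by rewrite invr_ge0 ltW.
have /(le_trans _) H : t^-1 ^+ n.+1 / n.+1`!%:R <= expR t^-1.
  by apply: le_trans (expR_ge1Dxn n ti0); rewrite lerDr.
rewrite expRN ler_pdivrMr ?expR_gt0//.
have tf : (0:R) < n.+1`!%:R by rewrite ltr0n fact_gt0.
have -> : t^-1 ^+ n = n.+1`!%:R * t * (t^-1 ^+ n.+1 / n.+1`!%:R).
  rewrite exprS; field; rewrite lt0r_neq0//= lt0r_neq0//.
by rewrite ler_wpM2l ?H// mulr_ge0 ?ltW.
Qed.

Lemma is_derive_flat n t :
  is_derive t 1 (flat n) (flat n.+2 t - n%:R * flat n.+1 t).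
Proof.
case: (ltgtP t 0) => [t0|t0|->].
- have -> : flat n.+2 t - n%:R * flat n.+1 t = 0.
    by rewrite /flat ltNge (ltW t0)/= mulr0 subr0.
  apply: (@near_eq_is_derive _ _ _ (cst 0)) => //.
  near=> s; rewrite /flat ltNge.
  suff -> : s <= 0 by [].
  by near: s; apply: lt_le_nbhsl.
- apply: (@near_eq_is_derive R R R (fun s : R => (s^-1 ^+ n * expR (- s^-1) : R))).
    near=> s; rewrite /flat.
    suff -> : 0 < s by [].
    by near: s; exact: lt_nbhsr.
  have t1 : t != 0 by rewrite gt_eqF.
  have H1 := is_deriveV t1 (is_derive_id t (1:R)).
  have H2 := @is_derive1_comp _ expR (fun s => - s^-1) t _ _ (is_derive_expR _) (is_deriveN H1).
  have H3 := is_deriveM (is_deriveX n H1) H2.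
  rewrite mulrfctE exprfctE in H3.
  apply: is_derive_eq H3 _.
  rewrite /flat t0 /GRing.scale /=.
  case: n => [|n] /=; first by rewrite !mul0r expr0; field.
  rewrite !exprS -[_ *+ n.+1]mulr_natl.
  by field.
- have E0 k : flat k 0 = 0 by rewrite /flat ltxx.
  rewrite !E0 mulr0 subr0.
  have lim0 : (fun h : R => h^-1 *: ((flat n \o shift 0) (h *: (1:R)) - flat n 0)) @ 0^'
      --> (0 : R).
    apply/cvgr0Pnorm_lt => e e0.
    have C0 : (0:R) < n.+2`!%:R by rewrite ltr0n fact_gt0.
    near=> h.
    have h0 : h != 0 by near: h; exact: nbhs_dnbhs_neq.
    rewrite /= E0 subr0 addr0 [h *: 1]mulr1.
    rewrite /GRing.scale /= [flat _ _]/flat; case: (ltP 0 h) => hp; last by rewrite mulr0 normr0.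
    (* For h > 0 the difference quotient at 0 is the next member of the family, which [flat_le]
       bounds by a multiple of h. *)
    have -> : h^-1 * (h^-1 ^+ n * expR (- h^-1)) = flat n.+1 h.
      by rewrite /flat hp exprS mulrA.
    have f0 : 0 <= flat n.+1 h.
      by rewrite /flat hp mulr_ge0 ?expR_ge0// exprn_ge0// invr_ge0 ltW.
    rewrite ger0_norm//; apply: le_lt_trans (flat_le _ hp) _.
    rewrite -ltr_pdivlMl// mulrC.
    have : `|h| < e / n.+2`!%:R by near: h; apply: dnbhs0_lt; rewrite divr_gt0.
    by rewrite gtr0_norm.
  split; first by apply/cvg_ex; exists 0.
  exact: cvg_lim lim0.
Unshelve. all: by end_near. Qed.

Lemma continuous_flat n : continuous (flat n).
Proof.
move=> t; apply: differentiable_continuous; apply/derivable1_diffP.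
by have [] := is_derive_flat n t.
Qed.

Lemma is_derive_flat_comp V n (u : V -> R) (y v : V) (d : R) : is_derive y v u d ->
  is_derive y v (fun z => flat n (u z)) ((flat n.+2 (u y) - n%:R * flat n.+1 (u y)) * d).
Proof.
rewrite -(add0r y) -(scale0r v) => /is_derive_line ud; apply/is_derive_line.
exact: (is_derive1_comp (is_derive_flat n _) ud).
Qed.

(** Induction on [k] with [n] free, since the chain rule brings in [flat n.+1] and [flat n.+2] of
    the same inner function. *)
Lemma Ck_at_flat V k n (u : V -> R) (x : V) :
  Ck_at k u x -> Ck_at k (fun y => flat n (u y)) x.
Proof.
have contf m (w : V -> R) : (\forall y \near x, {for y, continuous w}) ->
    \forall y \near x, {for y, continuous (fun y => flat m (w y))}.
  by apply: filterS => y wy; apply: continuous_comp wy _; exact: continuous_flat.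
elim: k n u => [|k IH] n u; first exact: contf.
move=> uC; have uk := Ck_at_le uC; case: uC => uc ud; split; first exact: contf.
move=> v; have [uv uk'] := ud v; split.
  by apply: filterS uv => y /derivableP /(is_derive_flat_comp n) [].
apply: (@Ck_at_near_eq _ _ _ (fun y => (flat n.+2 (u y) + (- n%:R) * flat n.+1 (u y)) * 'D_v u y)).
  by apply: filterS uv => y /derivableP /(is_derive_flat_comp n) [_ ->]; rewrite mulNr.
apply: Ck_atM uk'; apply: Ck_atD; first exact: IH.
by apply: Ck_atM; [exact: Ck_at_cst|exact: IH].
Qed.

End FlatFunction.

(** * Cutoff functions on a manifold *)

Section BumpFunction.
Local Notation coord := Defs.coord.
Variables (R : realType) (M : topologicalType) (m : nat) (A : set (chart R M m)).
Hypothesis hM : smooth_manifold A.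

Lemma Ck_at_sum (V : normedModType R) (k n : nat) (f : 'I_n -> V -> R) (x : V) :
  (forall i, Ck_at k (f i) x) -> Ck_at k (fun y => \sum_i f i y) x.
Proof.
elim: n f => [|n IH] f fk.
  apply: Ck_at_near_eq (Ck_at_cst k 0 x).
  by near=> y; rewrite big_ord0.
apply: Ck_at_near_eq (Ck_atD (fk ord0) (IH (fun i => f (lift ord0 i)) _)) => //.
by near=> y; rewrite big_ord_recl.
Unshelve. all: by end_near. Qed.

Lemma chart_param_nbhs (c : chart R M m) (q : M) (O : set M) :
  A c -> dom c q -> nbhs q O -> \forall x \near coord c q, O (param c x).
Proof.
move=> Ac cq Oq.
have := chart_param_continuous hM Ac cq; rewrite /prop_for /continuous_at.
by rewrite (chart_coordK hM Ac cq); apply.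
Qed.

(** In a chart around [p], take [flat 0] of r^2 - |x - x0|^2 for a small r, and extend by 0 outside
    the chart domain. *)
Lemma exists_bump (O : set M) (p : M) : open O -> O p ->
  exists phi : cinf A, phi p != 0 /\ forall q, ~ O q -> phi q = 0.
Proof.
move=> oO Op; have [c Ac cp] := manifold_cover hM p.
pose x0 := coord c p.
have [r r0 rP] : exists2 r : R, 0 < r &
    forall x, `|x0 - x| <= r -> (coord c @` dom c) x /\ O (param c x).
  have : \forall x \near x0, (coord c @` dom c) x /\ O (param c x).
    apply: filterI.
      by apply: open_nbhs_nbhs; split; [exact: chart_img_open hM _ Ac|exists p].
    exact: chart_param_nbhs Ac cp (open_nbhs_nbhs (conj oO Op)).
  move=> /nbhs_ballP[e /= e0 eP]; exists (e / 2); first by rewrite divr_gt0.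
  move=> x xe; apply: eP; rewrite -ball_normE /=.
  by apply: le_lt_trans xe _; rewrite ltr_pdivrMr// mulr2n mulrDr mulr1 ltrDl.
pose u (x : 'rV[R]_m) := r ^+ 2 - \sum_j (x 0 j - x0 0 j) ^+ 2.
(* [u] measures the Euclidean distance while rows carry the sup norm: the Euclidean ball lies in the
   sup ball. *)
have uP x : 0 < u x -> `|x0 - x| <= r.
  rewrite subr_gt0 => ux; rewrite [leLHS]/Num.Def.normr /= mx_normrE.
  apply/bigmax_leP; split=> [|[i j] _ /=]; first exact: ltW.
  rewrite ord1 !mxE -(@ler_pXn2r _ 2) ?nnegrE ?normr_ge0 ?(ltW r0)//.
  rewrite real_normK ?num_real//; apply: ltW; apply: le_lt_trans ux.
  rewrite (bigD1 j)//= -sqrrN opprB lerDl sumr_ge0// => k _; exact: sqr_ge0.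
pose phi q := if `[< dom c q >] then flat 0 (u (coord c q)) else 0.
have phiP q : phi q != 0 -> dom c q /\ `|x0 - coord c q| <= r.
  rewrite /phi; case: asboolP => [cq|_]; rewrite ?eqxx// /flat.
  by case: ltP => [/uP //|_]; rewrite eqxx.
(* The image of the closed ball is compact, hence closed since [M] is Hausdorff. Its complement is
   then a neighbourhood of every point outside the chart domain, and the extension by 0 is smooth
   there. *)
have K_closed : closed (param c @` [set x | `|x0 - x| <= r]).
  apply: compact_closed; first exact: manifold_hausdorff hM.
  apply: continuous_compact.
    apply: continuous_in_subspaceT => x /[!inE] /= /rP[[q cq <-] _].
    exact: chart_param_continuous hM _ Ac _ cq.
  apply: bounded_closed_compact; last exact: closed_closed_ball_.
  exists (`|x0| + r); split; first by rewrite num_real.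
  move=> s rs x /= xr; apply: le_trans (ltW rs).
  by rewrite -[x](subKr x0) (le_trans (ler_normB _ _))// lerD2l.
have phi_smooth : phi \in smooth_fun_pred A.
  apply/asboolP => c' Ac' q c'q k.
  have [cq|ncq] := pselect (dom c q).
    apply: (@Ck_at_near_eq _ _ _ (fun x => flat 0 (u (coord c (param c' x))))).
      have := chart_param_nbhs Ac' c'q (open_nbhs_nbhs (conj (chart_dom_open hM Ac) cq)).
      by apply: filterS => x cx; rewrite /phi asboolT.
    apply: Ck_at_flat.
    apply: (@Ck_at_near_eq _ _ _ (fun x => r ^+ 2 + (-1) *
        \sum_j (coord c (param c' x) 0 j + (- x0 0 j)) * (coord c (param c' x) 0 j + (- x0 0 j)))).
      by near=> x; rewrite /u mulN1r; congr (_ - _); apply: eq_bigr => j _; rewrite expr2.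
    apply: Ck_atD (Ck_at_cst _ _ _) (Ck_atM (Ck_at_cst _ _ _) (Ck_at_sum _)) => j.
    have cj : Ck_at k (fun x => coord c (param c' x) 0 j + (- x0 0 j)) (coord c' q).
      exact: Ck_atD (chart_transition hM Ac' Ac c'q cq j k) (Ck_at_cst _ _ _).
    exact: (Ck_atM cj cj).
  apply: Ck_at_near_eq (Ck_at_cst k 0 _).
  have /(chart_param_nbhs Ac' c'q) : nbhs q (~` (param c @` [set x | `|x0 - x| <= r])).
    apply: open_nbhs_nbhs; split; first exact: closed_openC.
    by move=> [x /rP[[q' cq' <-] _]]; rewrite (chart_coordK hM Ac cq') => qq; apply: ncq; rewrite -qq.
  apply: filterS => x nx; apply/esym/eqP; apply: contraPT nx => /phiP[cx xr].
  apply: contrapT => nx; apply: nx.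
  by move=> nx; apply: nx; exists (coord c (param c' x)) => //; exact: chart_coordK hM _ Ac _ cx.
exists (Cinf phi_smooth); split=> [|q nOq] /=.
  rewrite /phi asboolT// /flat /u big1 ?subr0 => [|j _]; last by rewrite subrr expr0n.
  by rewrite exprn_gt0// expr0 mul1r gt_eqF// expR_gt0.
apply/eqP; apply: contra_notT nOq => /phiP[cq /rP[_]].
by rewrite (chart_coordK hM Ac cq).
Unshelve. all: by end_near. Qed.

Lemma cinf_continuous (f : cinf A) : continuous f.
Proof.
move=> p; have [c Ac cp] := manifold_cover hM p.
have /asboolP fs := cinf_smooth f.
have /nbhs_singleton fc : \forall x \near coord c p,
  {for x, continuous (fun x => f (param c x))} := fs c Ac p cp 0%N.
have : {for p, continuous ((fun x => f (param c x)) \o coord c)}.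
  by apply: continuous_comp fc; exact: chart_coord_continuous hM _ Ac _ cp.
rewrite /prop_for /continuous_at /= (chart_coordK hM Ac cp); apply: cvg_trans.
apply: near_eq_cvg.
have := open_nbhs_nbhs (conj (chart_dom_open hM Ac) cp).
by apply: filterS => q cq /=; rewrite (chart_coordK hM Ac cq).
Qed.

End BumpFunction.

(** * Tensoriality *)

Section Evaluation.
Variables (R : realType) (M : topologicalType) (m : nat) (A : set (chart R M m)).
Implicit Types (f h : cinf A) (X Y : vf A) (p : M).

(** Evaluation gets a name so that it can carry a ring morphism structure: sums, products and
    determinants in C^oo(M) are then evaluated by the [rmorph] lemmas and [det_map_mx]. *)
Definition ev p f : R := f p.
Arguments ev : simpl never.

Lemma ev_zmod_morphism p : zmod_morphism (ev p).
Proof. by []. Qed.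

Lemma ev_monoid_morphism p : monoid_morphism (ev p).
Proof. by []. Qed.

HB.instance Definition _ p := GRing.isZmodMorphism.Build (cinf A) R (ev p) (ev_zmod_morphism p).
HB.instance Definition _ p := GRing.isMonoidMorphism.Build (cinf A) R (ev p) (ev_monoid_morphism p).

Lemma cinf_ext f h : (forall p, f p = h p) -> f = h.
Proof. by move=> fh; apply/val_inj/funext. Qed.

Lemma vf_der X (a : R) f h : X (cinf_cst A a * f + h) = cinf_cst A a * X f + X h.
Proof. by have /asboolP[] := vf_derivation X. Qed.

Lemma vfM X f h : X (f * h) = X f * h + f * X h.
Proof. by have /asboolP[] := vf_derivation X. Qed.

Lemma vf_zmod_morphism X : zmod_morphism X.
Proof.
move=> f h; have E : cinf_cst A (-1) = -1 by exact: cinf_ext.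
by rewrite addrC -mulN1r -E vf_der E mulN1r addrC.
Qed.

HB.instance Definition _ X := GRing.isZmodMorphism.Build (cinf A) (cinf A) X (vf_zmod_morphism X).

Lemma vf_add X Y f : (X + Y) f = X f + Y f.
Proof. by []. Qed.

Lemma vf_opp X f : (- X) f = - X f.
Proof. by []. Qed.

Lemma vf_scaleE h X f : (h *: X) f = h * X f.
Proof. by []. Qed.

Lemma vf_sum (I : finType) (X : I -> vf A) f : (\sum_i X i) f = \sum_i X i f.
Proof.
by elim/big_rec2: _ => // i Y X' _ <-.
Qed.

Lemma vf1 X : X 1 = 0.
Proof.
have := vfM X 1 1; rewrite !mulr1 mul1r => /esym/eqP.
by rewrite -subr_eq0 addrK => /eqP.
Qed.

End Evaluation.

(** * C^oo(M)-linear functionals and their values at a point *)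

Section Tensoriality.
Variables (R : realType) (M : topologicalType) (m : nat) (A : set (chart R M m)).
Hypothesis hM : smooth_manifold A.

Definition functional (L : vf A -> cinf A) : Prop :=
  forall (f : cinf A) (X Y : vf A), L (f *: X + Y) = f * L X + L Y.

Lemma functional0 L : functional L -> L 0 = 0.
Proof. by move=> Ll; have := Ll (-1) 0 0; rewrite scaler0 addr0 mulN1r addNr. Qed.

Lemma functionalZ L f X : functional L -> L (f *: X) = f * L X.
Proof. by move=> Ll; have := Ll f X 0; rewrite !addr0 functional0 ?addr0. Qed.

Lemma functional_sum L (I : finType) (c : I -> cinf A) (X : I -> vf A) :
  functional L -> L (\sum_i c i *: X i) = \sum_i c i * L (X i).
Proof.
move=> Ll; elim/big_rec2: _ => [|i y1 y2 _ <-]; first exact: functional0.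
exact: Ll.
Qed.

(** A bump function [phi] supported in [O] gives [phi *: W = 0], and [phi] leaves [L] as a factor
    that is nonzero at [p]. *)
Lemma functional_local L (O : set M) (p : M) (W : vf A) : functional L ->
  open O -> O p -> (forall q, O q -> eq_at q W 0) -> L W p = 0.
Proof.
move=> Ll oO Op W0; have [phi [phip phi0]] := exists_bump hM oO Op.
have phiW : phi *: W = 0.
  apply: vf_ext => f; apply: cinf_ext => q.
  rewrite vf_scaleE; change (phi q * W f q = 0).
  have [Oq|/phi0 ->] := pselect (O q); last by rewrite mul0r.
  by rewrite W0// mulr0.
have /esym/eqP := congr1 (ev p) (functionalZ phi W Ll).
by rewrite phiW functional0// rmorphM rmorph0 mulf_eq0 (negPf phip)/= => /eqP.
Qed.

(** Locality of functionals only concerns fields vanishing on an open set; dependence on the value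
    at [q] alone is isolated here as a property of the point. *)
Definition tensorial_at (q : M) : Prop := forall (L : vf A -> cinf A) (V : vf A),
  functional L -> eq_at q V 0 -> L V q = 0.

(* Take a maximal minor [det (X_i f_j)] that does not vanish identically on [W].
   The bordered minors vanish on [W], and expanding them along the border gives
   a relation [det (X_i f_j) *: V + \sum_i c_i *: X_i = 0] on [W], whose
   coefficients [c_i] vanish wherever [V] does. *)
Lemma tensorial_dense (W : set M) (k : nat) (E : 'I_k -> vf A) (p0 : M) :
  open W -> W p0 ->
  (forall q, W q -> forall X : vf A,
     exists a : 'I_k -> R, forall f, X f q = \sum_i a i * E i f q) ->
  exists2 q, W q & tensorial_at q.
Proof.
move=> oW Wp0 Espan.
pose P r := `[< exists (X : 'I_r -> vf A) (f : 'I_r -> cinf A) q,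
   W q /\ \det (\matrix_(i, j) X i (f j) q) != 0 >].
have P0 : exists r, P r.
  exists 0%N; apply/asboolP; exists (fun=> 0), (fun=> 0), p0.
  by split=> //; rewrite det_mx00 oner_neq0.
have Pk r : P r -> (r <= k)%N.
  move=> /asboolP[X [f [q [Wq dq]]]].
  have /choice[a aE] := fun i => Espan q Wq (X i).
  have : row_free (\matrix_(i, j) X i (f j) q) by rewrite row_free_unit unitmxE unitfE.
  (* Expanding the [X i] on the [k] vectors [E l] factors the matrix through dimension [k], which
     bounds its rank. *)
  have -> : \matrix_(i, j) X i (f j) q =
      (\matrix_(i, l) a i l) *m (\matrix_(l, j) E l (f j) q).
    apply/matrixP => i j; rewrite !mxE aE; apply: eq_bigr => l _; by rewrite !mxE.
  move=> /eqP <-; apply: leq_trans (mulmx_max_rank _ _) _ => //.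
have [r /asboolP[X [f [q [Wq dq]]]] rmax] := ex_maxnP P0 Pk.
exists q => // L V Ll V0.
pose X' (i : 'I_r.+1) := if unlift ord_max i is Some j then X j else V.
pose C := \matrix_(i < r.+1, j < r) X' i (f j).
(* Cofactors along the last column do not involve the function [h] placed in that column, so the
   relation below holds for all [h] at once, as one between vector fields. *)
pose c (i : 'I_r.+1) : cinf A := (-1) ^+ (i + @ord_max r) * \det (row' i C).
have cW h q' : W q' -> (\sum_i c i *: X' i) h q' = 0.
  move=> Wq'.
  pose f' (j : 'I_r.+1) := if unlift ord_max j is Some l then f l else h.
  have -> : (\sum_i c i *: X' i) h = \det (\matrix_(i, j) X' i (f' j)).
    rewrite vf_sum (expand_det_col _ ord_max); apply: eq_bigr => i _.
    rewrite vf_scaleE mulrC mxE /f' unlift_none; congr (_ * (_ * \det _)).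
    by apply/matrixP => i' j; rewrite !mxE liftK.
  have -> : (\det (\matrix_(i, j) X' i (f' j))) q' =
      ev q' (\det (\matrix_(i, j) X' i (f' j))) by [].
  rewrite -det_map_mx; apply/eqP; apply: contraT => dq'.
  have /rmax : P r.+1; last by rewrite ltnn.
  apply/asboolP; exists X', f', q'; split=> //.
  by apply: contra_neq dq' => <-; congr (\det _); apply/matrixP => i j; rewrite !mxE.
have := functional_local Ll oW Wq (fun q' Wq' h => cW h q' Wq').
rewrite (functional_sum _ _ Ll) => E0.
have : ev q (\sum_i c i * L (X' i)) = 0 by exact: E0.
rewrite rmorph_sum (bigD1 ord_max)// big1 => [|i ni].
  rewrite Monoid.mulm1 rmorphM [X' _]/X' unlift_none => /eqP; rewrite mulf_eq0 => /orP[|/eqP//].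
  rewrite rmorphM rmorph_sign mulf_eq0 signr_eq0 orFb -det_map_mx => cq.
  move: dq; rewrite -(eqP cq) => /eqP[]; congr (\det _).
  by apply/matrixP => i j; rewrite !mxE /X' liftK.
rewrite !rmorphM -det_map_mx.
have [i' Ei' _] := unlift_some ni.
rewrite (expand_det_row _ i') big1 ?mulr0 ?mul0r// => j _.
rewrite !mxE -Ei' /X' unlift_none [X in X * _](_ : _ = 0) ?mul0r//; exact: V0.
Qed.

End Tensoriality.

(** * Hadamard's lemma in the time direction *)

Section UnitIntegral.
Variable R : realType.
Implicit Types f g : R -> R.

Definition int01 f : R := \int[@lebesgue_measure R]_(s in `[0, 1]) f s.

Definition cont01 f : Prop := forall s : R, 0 <= s <= 1 -> {for s, continuous f}.

Lemma cont01_within f : cont01 f -> {within `[0, 1], continuous f}.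
Proof.
by move=> fc; apply: continuous_in_subspaceT => s /[!inE] /=; rewrite in_itv/=; exact: fc.
Qed.

Lemma cont01_integrable f : cont01 f ->
  (@lebesgue_measure R).-integrable `[0, 1] (EFin \o f).
Proof.
move=> fc; apply: continuous_compact_integrable; first exact: segment_compact.
exact: cont01_within.
Qed.

Lemma int01D f g : cont01 f -> cont01 g ->
  int01 (fun s => f s + g s) = int01 f + int01 g.
Proof. by move=> fc gc; apply: RintegralD => //; exact: cont01_integrable. Qed.

Lemma int01Z (a : R) f : cont01 f -> int01 (fun s => a * f s) = a * int01 f.
Proof. by move=> fc; apply: RintegralZl => //; exact: cont01_integrable. Qed.

Lemma int01_cst (a : R) : int01 (fun=> a) = a.
Proof.
rewrite /int01 Rintegral_cst//= lebesgue_measure_itv/= lte_fin ltr01.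
by rewrite oppr0 addr0 mulr1.
Qed.

(** The interval has length 1, so a uniform bound on the integrands bounds the integrals. Limits
    under the integral sign go through this estimate. *)
Lemma int01_dist f g (e : R) : cont01 f -> cont01 g ->
  (forall s, 0 <= s <= 1 -> `|f s - g s| <= e) -> `|int01 f - int01 g| <= e.
Proof.
move=> fc gc fge.
have fgc : cont01 (fun s => f s - g s).
  by move=> s s01; apply: continuousB; [exact: fc|exact: gc].
have H : int01 (fun s => `|f s - g s|) <= int01 (fun=> e).
  apply: le_Rintegral => //.
  - apply: cont01_integrable => s s01.
    by apply: (@continuous_comp _ _ _ (fun s => f s - g s)); [exact: fgc|exact: norm_continuous].
  - by apply: cont01_integrable => s _; exact: cst_continuous.
rewrite int01_cst in H; apply: le_trans H.
rewrite /int01 -RintegralB//; [|exact: cont01_integrable..].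
by apply: le_normr_Rintegral => //; exact: cont01_integrable.
Qed.

Lemma int01_derive f g : cont01 g -> (forall s : R, is_derive s 1 f (g s)) ->
  int01 g = f 1 - f 0.
Proof.
move=> gc fg.
have fc : continuous f.
  by move=> s; apply/differentiable_continuous/derivable1_diffP; have [] := fg s.
rewrite /int01 /Rintegral (continuous_FTC2 ltr01 (cont01_within gc) (F := f))//.
- split.
  + by move=> s _; have [] := fg s.
  + by apply: cvg_at_right_filter; exact: fc.
  + by apply: cvg_at_left_filter; exact: fc.
- by move=> s _; rewrite derive1E; have [_ ->] := fg s.
Qed.

End UnitIntegral.

(** * Directional derivatives *)

Section DirectionalDerivative.
Variables (R : realType) (V : normedModType R).
Implicit Types (f : V -> R) (y u v : V).

Lemma is_deriveZ_dir f y v (s d : R) :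
  is_derive y v f d -> is_derive y (s *: v) f (s * d).
Proof.
rewrite -{1}(add0r y) -(scale0r v) => /is_derive_line fd.
rewrite -(add0r y) -(scale0r (s *: v)); apply/is_derive_line.
have H1 : is_derive (0 : R) 1 (fun r : R => r * s) s.
  apply: is_derive_eq (is_deriveM (is_derive_id (0:R) (1:R)) (is_derive_cst s (0:R) (1:R))) _.
  by rewrite scaler0 add0r /GRing.scale /= mulr1.
have H2 : is_derive (0 * s) 1 (fun r => f (r *: v + y)) d by rewrite mul0r.
have -> : (fun r : R => f (r *: (s *: v) + y)) =
    (fun r => f (r *: v + y)) \o (fun r => r * s).
  by apply/funext => r /=; rewrite scalerA.
apply: is_derive_eq (@is_derive1_comp _ (fun r => f (r *: v + y)) (fun r => r * s)
  0 _ _ H2 H1) _.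
by rewrite mulrC.
Qed.

(** The mean value theorem on the line through [y], between 0 and [h]; bounding [c] in absolute
    value covers both signs of [h]. *)
Lemma directional_MVT f y v (h : R) :
  (forall c : R, `|c| <= `|h| -> derivable f (c *: v + y) v) ->
  exists2 c, `|c| <= `|h| & f (h *: v + y) - f y = h * 'D_v f (c *: v + y).
Proof.
move=> fd.
have D (c : R) : `|c| <= `|h| ->
    is_derive c 1 (fun r => f (r *: v + y)) ('D_v f (c *: v + y)).
  by move=> ch; apply: (is_derive_line f y v c _).1; apply: DeriveDef => //; exact: fd.
have C (a b : R) : (forall c, c \in `[a, b] -> `|c| <= `|h|) ->
    {within `[a, b], continuous (fun r => f (r *: v + y))}.
  move=> abh; apply: continuous_in_subspaceT => c /set_mem /abh ch.
  by apply/differentiable_continuous/derivable1_diffP; have [] := D c ch.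
have [h0|h0] := leP 0 h.
  have H c : c \in `[0, h] -> `|c| <= `|h|.
    by rewrite in_itv/= => /andP[c0 ch]; rewrite !ger0_norm.
  have [|c cI] := @MVT_segment R (fun r => f (r *: v + y)) (fun r => 'D_v f (r *: v + y)) _ _ h0 _ (C _ _ H); last first.
    by rewrite scale0r add0r subr0 mulrC => E; exists c => //; exact: H.
  by move=> c /subset_itv_oo_cc /H /D.
have H c : c \in `[h, 0] -> `|c| <= `|h|.
  by rewrite in_itv/= => /andP[hc c0]; rewrite !ler0_norm ?lerN2 ?(ltW h0).
have [|c cI] := @MVT_segment R (fun r => f (r *: v + y)) (fun r => 'D_v f (r *: v + y)) _ _ (ltW h0) _ (C _ _ H); last first.
  rewrite scale0r add0r sub0r mulrN mulrC => /(congr1 -%R); rewrite opprB opprK => E.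
  by exists c => //; exact: H.
by move=> c /subset_itv_oo_cc /H /D.
Qed.

(** Go from [y] to [h *: (u + v) + y] through [h *: u + y]. By the mean value theorem the second leg
    contributes the derivative along [v] at a nearby point, and continuity of that derivative gives
    the limit. *)
Lemma is_deriveD_dir f y u v :
  (\forall z \near y, derivable f z v) -> derivable f y u ->
  {for y, continuous (fun z => 'D_v f z)} ->
  is_derive y (u + v) f ('D_u f y + 'D_v f y).
Proof.
move=> fv fu fc.
suff L : (fun h : R => h^-1 *: ((f \o shift y) (h *: (u + v)) - f y)) @ 0^' -->
    'D_u f y + 'D_v f y.
  by split; [apply/cvg_ex; exists ('D_u f y + 'D_v f y)|exact: cvg_lim L].
have Lu : (fun h : R => h^-1 *: ((f \o shift y) (h *: u) - f y)) @ 0^' --> 'D_u f y by exact: fu.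
have Lv : (fun h : R => h^-1 *: (f (h *: (u + v) + y) - f (h *: u + y))) @ 0^' --> 'D_v f y.
  apply/cvgrPdist_lt => e e0.
  have /nbhs_ballP[d /= d0 dP] : \forall z \near y,
      derivable f z v /\ `|'D_v f y - 'D_v f z| < e.
    by apply: filterI => //; move/cvgrPdist_lt: fc => /(_ e e0).
  have uv0 : 0 < `|u| + `|v| + 1 by rewrite ltr_wpDl// addr_ge0.
  near=> h.
  have h0 : h != 0 by near: h; exact: nbhs_dnbhs_neq.
  have hd : `|h| < d / (`|u| + `|v| + 1) by near: h; apply: dnbhs0_lt; rewrite divr_gt0.
  have ball_c c : `|c| <= `|h| -> ball y d (c *: v + (h *: u + y)).
    move=> ch; rewrite -ball_normE /= -normrN opprB addrA addrK.
    apply: (le_lt_trans (ler_normD _ _)); rewrite !normrZ.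
    apply: (@le_lt_trans _ _ (`|h| * (`|u| + `|v| + 1))); last by rewrite -ltr_pdivlMr.
    have cv : `|c| * `|v| <= `|h| * `|v| by rewrite ler_wpM2r.
    have := normr_ge0 h; rewrite !mulrDr; lra.
  have [c ch E] := @directional_MVT f (h *: u + y) v h (fun c ch => (dP _ (ball_c c ch)).1).
  have -> : h *: (u + v) + y = h *: v + (h *: u + y).
    by rewrite scalerDr [h *: u + h *: v]addrC -addrA.
  rewrite E /GRing.scale /= mulKf//.
  exact: (dP _ (ball_c c ch)).2.
rewrite [X in _ --> X]addrC; apply: cvg_trans (cvgD Lv Lu).
apply: near_eq_cvg; near=> h => /=.
by rewrite -[LHS]/(h^-1 *: _ + h^-1 *: _) -scalerDr addrA subrK.
Unshelve. all: by end_near. Qed.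

End DirectionalDerivative.

(** * Smoothness of integrals along segments *)

Section SegmentIntegral.
Variables (R : realType) (V : normedModType R) (P Q : {linear V -> V}) (w : V).
Hypotheses (P_continuous : continuous P) (Q_continuous : continuous Q).
Variable (Omega : set V).
Hypothesis Omega_open : open Omega.

(** In the application [P] and [Q] are the space and time projections and [w] carries a time t0: the
    point then has the space part of [y] and runs from time t0 to the time of [y]. *)
Definition segment_pt (s : R) (y : V) : V := P y + s *: Q y + (1 - s) *: w.
Local Notation a := segment_pt.

Definition segment_dom : set V := [set y | forall s, 0 <= s <= 1 -> Omega (a s y)].

(* The derivative of the moment of order [j] involves the moments of orders [j]
   and [j + 1]: smoothness is proved for all orders at once. *)
Definition segment_moment (j : nat) (phi : V -> R) (y : V) : R :=
  int01 (fun s => s ^+ j * phi (a s y)).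

Lemma segment_pt_continuous : continuous (fun sy : R * V => a sy.1 sy.2).
Proof.
move=> [s y]; apply: cvgD; first apply: cvgD.
- by apply: (@cvg_comp _ _ _ snd P); [exact: cvg_snd|exact: P_continuous].
- apply: cvgZ; first exact: cvg_fst.
  by apply: (@cvg_comp _ _ _ snd Q); [exact: cvg_snd|exact: Q_continuous].
- apply: cvgZ; last exact: cvg_cst.
  by apply: cvgB; [exact: cvg_cst|exact: cvg_fst].
Qed.

Lemma segment_pt_continuousl y : continuous (fun s : R => a s y).
Proof.
move=> s; apply: cvgD; first apply: cvgD.
- exact: cvg_cst.
- by apply: cvgZ; [exact: cvg_id|exact: cvg_cst].
- apply: cvgZ; last exact: cvg_cst.
  by apply: cvgB; [exact: cvg_cst|exact: cvg_id].
Qed.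

Lemma segment_pt_line s (h : R) v y :
  a s (h *: v + y) = h *: (P v + s *: Q v) + a s y.
Proof.
rewrite /a [P _]linearP [Q _]linearP /= !scalerDr !scalerA [s * h]mulrC.
by rewrite [_ + (_ + _)]addrACA -!addrA.
Qed.

Lemma segment_near (phi : V -> R) (s : R) (y0 : V) (e : R) :
  (forall z, Omega z -> {for z, continuous phi}) -> Omega (a s y0) -> 0 < e ->
  \forall sy \near ((s, y0) : R * V), Omega (a sy.1 sy.2) /\
    `|phi (a sy.1 sy.2) - phi (a sy.1 y0)| < e.
Proof.
move=> phic Os e0.
have ac : (fun sy : R * V => a sy.1 sy.2) @ (s, y0) --> a s y0.
  exact: (@segment_pt_continuous (s, y0)).
have ac0 : (fun sy : R * V => a sy.1 y0) @ (s, y0) --> a s y0.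
  apply: (@cvg_comp _ _ _ fst (fun r : R => a r y0)); first exact: cvg_fst.
  exact: segment_pt_continuousl.
have e2 : 0 < e / 2 by rewrite divr_gt0.
have /cvgrPdist_lt/(_ _ e2) phis := phic _ Os.
have O1 : \forall z \near a s y0, Omega z by exact: open_nbhs_nbhs.
have O2 : \forall z \near a s y0, Omega z /\ `|phi (a s y0) - phi z| < e / 2.
  exact: filterI O1 phis.
have H1 : \forall sy \near ((s, y0) : R * V), Omega (a sy.1 sy.2) /\
    `|phi (a s y0) - phi (a sy.1 sy.2)| < e / 2 by exact: ac O2.
have H2 : \forall sy \near ((s, y0) : R * V),
    `|phi (a s y0) - phi (a sy.1 y0)| < e / 2 by exact: ac0 phis.
apply: filterS2 H1 H2 => -[s' y] /= [Oz d1] d2; split=> //.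
rewrite (le_lt_trans (ler_distD (phi (a s y0)) _ _))// [e]splitr ltrD//.
by rewrite distrC.
Qed.

(** Tube lemma: compactness of [0, 1] makes the estimate of [segment_near] uniform in [s]. *)
Lemma segment_tube (phi : V -> R) (y0 : V) (e : R) :
  (forall z, Omega z -> {for z, continuous phi}) -> segment_dom y0 -> 0 < e ->
  \forall y \near y0, forall s, 0 <= s <= 1 ->
    Omega (a s y) /\ `|phi (a s y) - phi (a s y0)| < e.
Proof.
move=> phic y0d e0.
have /compact_near_coveringP cov := @segment_compact R 0 1.
have {}cov := cov V (nbhs y0)
  (fun y s => Omega (a s y) /\ `|phi (a s y) - phi (a s y0)| < e) (nbhs_filter y0).
apply: filterS (cov _) => [y yP s s01|]; first by apply: yP; rewrite /= in_itv.
move=> s; rewrite /= in_itv/= => s01.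
exact: segment_near phic (y0d s s01) e0.
Qed.

Lemma segment_dom_open (y : V) : segment_dom y -> \forall z \near y, segment_dom z.
Proof.
move=> yd; have := @segment_tube (fun=> 0) y 1 _ yd ltr01.
move=> /(_ (fun z _ => @cst_continuous _ _ _ z)).
by apply: filterS => z zP s s01; have [] := zP s s01.
Qed.

Lemma segment_cont01 (j : nat) (phi : V -> R) (y : V) :
  (forall z, Omega z -> {for z, continuous phi}) -> segment_dom y ->
  cont01 (fun s => s ^+ j * phi (a s y)).
Proof.
move=> phic yd s s01; apply: continuousM; first exact: exprn_continuous.
apply: (@continuous_comp _ _ _ (fun s : R => a s y)).
  exact: segment_pt_continuousl.
exact/phic/yd.
Qed.

Lemma segment_moment_continuous (j : nat) (phi : V -> R) (y : V) :
  (forall z, Omega z -> {for z, continuous phi}) -> segment_dom y ->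
  {for y, continuous (segment_moment j phi)}.
Proof.
move=> phic yd; apply/cvgrPdist_le => e e0.
have := segment_tube phic yd e0; have := segment_dom_open yd.
apply: filterS2 => z zd zP; apply: int01_dist; [exact: segment_cont01..|].
move=> s s01; rewrite -mulrBr normrM distrC.
have [s0 s1] := andP s01.
rewrite -[e]mul1r ler_pM// ?normr_ge0//; last by rewrite ltW//; exact: (zP s s01).2.
by rewrite normrX ger0_norm// exprn_ile1.
Qed.

(** Differentiation under the integral sign. When [y] moves along [v], the point at parameter [s]
    moves along [P v + s *: Q v]; the extra factor [s] raises the order of the second moment. *)
Lemma is_derive_segment_moment (j : nat) (phi : V -> R) (y v : V) :
  (forall z u, Omega z -> derivable phi z u) ->
  (forall z, Omega z -> {for z, continuous phi}) ->
  (forall z u, Omega z -> {for z, continuous (fun z => 'D_u phi z)}) ->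
  segment_dom y ->
  is_derive y v (segment_moment j phi)
    (segment_moment j (fun z => 'D_(P v) phi z) y +
     segment_moment j.+1 (fun z => 'D_(Q v) phi z) y).
Proof.
move=> phid phic phi1 yd.
set d1 := fun z => 'D_(P v) phi z; set d2 := fun z => 'D_(Q v) phi z.
have c1 z : Omega z -> {for z, continuous d1} by exact: phi1.
have c2 z : Omega z -> {for z, continuous d2} by exact: phi1.
set l := _ + _.
suff L : (fun h : R => h^-1 *: ((segment_moment j phi \o shift y) (h *: v) -
    segment_moment j phi y)) @ 0^' --> l.
  by split; [apply/cvg_ex; exists l|exact: cvg_lim L].
have DL z s : Omega z -> 'D_(P v + s *: Q v) phi z = d1 z + s * d2 z.
  move=> Oz.
  have O1 : \forall z' \near z, Omega z' by exact: open_nbhs_nbhs.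
  have E2 z' : Omega z' -> is_derive z' (s *: Q v) phi (s * d2 z').
    by move=> Oz'; apply: is_deriveZ_dir; apply: DeriveDef => //; exact: phid.
  have [|||_ ->] := @is_deriveD_dir _ _ phi z (P v) (s *: Q v).
  - by apply: filterS O1 => z' /E2[].
  - exact: phid.
  - exact: phi1.
  by have [_ ->] := E2 z Oz.
apply/cvgrPdist_le => e e0.
have e2 : 0 < e / 2 by rewrite divr_gt0.
have : \forall z \near y, segment_dom z /\ forall s, 0 <= s <= 1 ->
    `|d1 (a s z) - d1 (a s y)| < e / 2 /\ `|d2 (a s z) - d2 (a s y)| < e / 2.
  apply: filterS2 (filterI (segment_dom_open yd) (segment_tube c1 yd e2)) (segment_tube c2 yd e2).
  move=> z [zd z1] z2; split=> // s s01.
  by split; [exact: (z1 s s01).2|exact: (z2 s s01).2].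
move=> /nbhs_ballP[r /= r0 rP].
have v0 : 0 < `|v| + 1 by rewrite ltr_wpDl.
near=> h.
have h0 : h != 0 by near: h; exact: nbhs_dnbhs_neq.
have hr : `|h| < r / (`|v| + 1) by near: h; apply: dnbhs0_lt; rewrite divr_gt0.
have ball_c (c : R) : `|c| <= `|h| -> ball y r (c *: v + y).
  move=> ch; rewrite -ball_normE /= -normrN opprB addrK normrZ.
  apply: le_lt_trans (_ : `|h| * (`|v| + 1) < r); last by rewrite -ltr_pdivlMr.
  by rewrite ler_pM// lerDl.
have [hd _] := rP _ (ball_c h (lexx _)).
have -> : l = int01 (fun s => s ^+ j * d1 (a s y) + s ^+ j.+1 * d2 (a s y)).
  by rewrite int01D//; exact: segment_cont01.
have -> : h^-1 *: ((segment_moment j phi \o shift y) (h *: v) - segment_moment j phi y) =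
    int01 (fun s => h^-1 * (s ^+ j * phi (a s (h *: v + y)) + (-1) * (s ^+ j * phi (a s y)))).
  have C1 : cont01 (fun s => s ^+ j * phi (a s (h *: v + y))) by exact: segment_cont01.
  have C2 : cont01 (fun s => s ^+ j * phi (a s y)) by exact: segment_cont01.
  have C3 : cont01 (fun s => (-1) * (s ^+ j * phi (a s y))).
    by move=> s s01; apply: continuousM; [exact: cst_continuous|exact: C2].
  rewrite int01Z; last by move=> s s01; apply: continuousD; [exact: C1|exact: C3].
  by rewrite int01D// int01Z// mulN1r.
apply: int01_dist.
- by move=> s s01; apply: continuousD; exact: segment_cont01.
- move=> s s01; apply: continuousM; first exact: cst_continuous.
  apply: continuousD; first exact: segment_cont01.
  by apply: continuousM; [exact: cst_continuous|exact: segment_cont01].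
move=> s s01; have [s0 s1] := andP s01.
have Oc (c : R) : `|c| <= `|h| -> Omega (c *: (P v + s *: Q v) + a s y).
  by move=> /ball_c /rP[cd _]; rewrite -segment_pt_line; exact: cd.
(* The difference quotient under the integral is a derivative at an intermediate point, within
   [e / 2] of its value at [y] for each of the two directions. *)
have [c ch E] := directional_MVT (fun c ch => phid _ (P v + s *: Q v) (Oc c ch)).
rewrite mulN1r -mulrBr segment_pt_line E DL; last exact: Oc.
rewrite [s ^+ j * (h * _)]mulrCA mulKf// exprSr -mulrA -mulrDr -mulrBr normrM.
have [_ /(_ s s01)] := rP _ (ball_c c ch).
rewrite segment_pt_line; set x1 := d1 _; set y1 := d1 _; set x2 := d2 _; set y2 := d2 _.
move=> [n1 n2].
rewrite -[e]mul1r ler_pM// ?normr_ge0//; first by rewrite normrX ger0_norm// exprn_ile1.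
have -> : y1 + s * y2 - (x1 + s * x2) = - ((x1 - y1) + s * (x2 - y2)) by ring.
rewrite normrN (le_trans (ler_normD _ _))// [e]splitr lerD ?(ltW n1)//.
by rewrite normrM ger0_norm// -[e / 2]mul1r ler_pM// ltW.
Unshelve. all: by end_near. Qed.

Lemma Ck_at_segment_moment (k j : nat) (phi : V -> R) (y : V) :
  (forall z, Omega z -> Ck_at k phi z) -> segment_dom y ->
  Ck_at k (segment_moment j phi) y.
Proof.
have near_cont i (f : V -> R) x : (forall z, Omega z -> {for z, continuous f}) ->
    segment_dom x -> \forall z \near x, {for z, continuous (segment_moment i f)}.
  by move=> fc /segment_dom_open; apply: filterS => z; exact: segment_moment_continuous.
elim: k j phi y => [|k IH] j phi y phik yd.
  by apply: near_cont => // z /phik /nbhs_singleton.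
have phic z : Omega z -> {for z, continuous phi}.
  by move=> /phik /Ck_at_cont /nbhs_singleton.
have phid z u : Omega z -> derivable phi z u.
  by move=> /phik[_ /(_ u)[/nbhs_singleton]].
have phi1 z u : Omega z -> {for z, continuous (fun z => 'D_u phi z)}.
  by move=> /phik[_ /(_ u)[_ /Ck_at_cont /nbhs_singleton]].
split; first exact: near_cont.
move=> v; have D z (zd : segment_dom z) := is_derive_segment_moment j v phid phic phi1 zd.
have yd' := segment_dom_open yd.
split; first by apply: filterS yd' => z /D[].
apply: (@Ck_at_near_eq _ _ _ (fun z => segment_moment j (fun z => 'D_(P v) phi z) z +
     segment_moment j.+1 (fun z => 'D_(Q v) phi z) z)).
  by apply: filterS yd' => z /D[_ ->].
by apply: Ck_atD; apply: IH => // z /phik[_ H]; apply: (H _).2.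
Qed.

End SegmentIntegral.

(** * Space and time projections of rows *)

Section RowProjections.
Variables (R : realType) (m : nat).

Definition left_part (v : 'rV[R]_(m + 1)) : 'rV[R]_(m + 1) := row_mx (lsubmx v) 0.
Definition right_part (v : 'rV[R]_(m + 1)) : 'rV[R]_(m + 1) := row_mx 0 (rsubmx v).

Lemma left_part_is_linear : linear left_part.
Proof.
by move=> k u v; rewrite /left_part linearP scale_row_mx add_row_mx scaler0 addr0.
Qed.

Lemma right_part_is_linear : linear right_part.
Proof.
by move=> k u v; rewrite /right_part linearP scale_row_mx add_row_mx scaler0 addr0.
Qed.

HB.instance Definition _ := GRing.isLinear.Build R _ _ _ left_part left_part_is_linear.
HB.instance Definition _ := GRing.isLinear.Build R _ _ _ right_part right_part_is_linear.

Lemma row_mx_continuous (T : topologicalType) (f : T -> 'rV[R]_m) (g : T -> 'rV[R]_1) :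
  continuous f -> continuous g -> continuous (fun x => row_mx (f x) (g x)).
Proof.
move=> fc gc x B /nbhs_ballP[e /= e0 eB].
have Hf : \forall y \near x, ball (f x) e (f y) by apply: fc; exact: nbhsx_ballx.
have Hg : \forall y \near x, ball (g x) e (g y) by apply: gc; exact: nbhsx_ballx.
apply: filterS2 Hf Hg => y [_ fy] [_ gy]; apply: eB; split=> // i j.
by rewrite !mxE; case: splitP => l _; [exact: fy|exact: gy].
Qed.

Lemma left_part_continuous : continuous left_part.
Proof.
by apply: row_mx_continuous => x; [exact: continuous_lsubmx|exact: cst_continuous].
Qed.

Lemma right_part_continuous : continuous right_part.
Proof.
by apply: row_mx_continuous => x; [exact: cst_continuous|exact: continuous_rsubmx].
Qed.

End RowProjections.

(** * Differentiation in time on M x R *)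

Section TimeDerivative.
Variables (R : realType) (M : topologicalType) (m : nat) (A : set (chart R M m)).
Hypothesis hM : smooth_manifold A.
Local Notation coord := Defs.coord.
Local Notation prod_atlas := (prod_atlas A).

Lemma time_slice_smooth (F : cinf prod_atlas) (p : M) (t : R) (k : nat) :
  Ck_at k (fun s => F (p, s)) t.
Proof.
have [c Ac cp] := manifold_cover hM p.
have /asboolP Fs := cinf_smooth F.
have Fk := Fs _ (ex_intro2 _ _ c Ac erefl) (p, t) cp k.
pose b (s : R) : 'rV[R]_(m + 1) := row_mx (coord c p) (const_mx s).
pose L (s : R) : 'rV[R]_(m + 1) := row_mx 0 (const_mx s).
have := @Ck_at_comp_affine R R _ k _ b L t _ _ Fk.
rewrite /b /L /= => H; apply: Ck_at_near_eq (H _ _).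
- by near=> s; rewrite row_mxKl row_mxKr mxE (chart_coordK hM Ac cp).
- apply: row_mx_continuous; first exact: cst_continuous.
  move=> s B /nbhs_ballP[e /= e0 eB]; apply/nbhs_ballP; exists e => // s' ss'.
  by apply: eB; split=> // i j; rewrite !mxE.
- move=> y h v; rewrite scale_row_mx add_row_mx scaler0 add0r; congr row_mx.
  by apply/matrixP => i j; rewrite !mxE.
Unshelve. all: by end_near. Qed.

Lemma time_slice_continuous (F : cinf prod_atlas) (p : M) :
  continuous (fun s => F (p, s)).
Proof. by move=> t; have /nbhs_singleton := time_slice_smooth F p t 0. Qed.

Lemma time_slice_affine_continuous (F : cinf prod_atlas) (p : M) (t d : R) :
  continuous (fun s : R => F (p, t + s * d)).
Proof.
move=> s; apply: (@continuous_comp R R R (fun s => t + s * d) (fun r => F (p, r))).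
  apply: (@continuousD R R R); first exact: cst_continuous.
  by apply: (@continuousM R R); [exact: cvg_id|exact: cst_continuous].
exact: time_slice_continuous.
Qed.

Variable (D : vf prod_atlas).
Hypothesis hD : is_ddt D.

Lemma is_derive_time_slice (F : cinf prod_atlas) (p : M) (t : R) :
  is_derive t 1 (fun s => F (p, s)) (D F (p, t)).
Proof.
rewrite hD derive1E; apply: DeriveDef => //.
by have [_ /(_ 1)[/nbhs_singleton]] := time_slice_smooth F p t 1.
Qed.

(** [H] is the mean of the time derivative of [F] over the segment from [t0] to [t]. The formula is
    the fundamental theorem of calculus; smoothness holds because [H] is a moment of order 0 in each
    product chart. *)
Lemma hadamard_time (F : cinf prod_atlas) (t0 : R) :
  exists H : cinf prod_atlas, forall p,
    H (p, t0) = D F (p, t0) /\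
    forall t, F (p, t) = F (p, t0) + (t - t0) * H (p, t).
Proof.
pose H (q : M * R) := int01 (fun s => D F (q.1, t0 + s * (q.2 - t0))).
have Hs : H \in smooth_fun_pred prod_atlas.
  apply/asboolP => _ [c Ac <-] [p t] /= cp k.
  (* [phi] is controlled where the space part lies in the chart image; the segment stays there, its
     space part being constant. *)
  pose Om : set 'rV[R]_(m + 1) := [set z | (coord c @` dom c) (lsubmx z)].
  pose phi (z : 'rV[R]_(m + 1)) := D F (param c (lsubmx z), rsubmx z 0 0).
  have Om_open : open Om.
    apply: open_comp; last exact: chart_img_open hM _ Ac.
    by move=> z _; exact: continuous_lsubmx.
  pose w : 'rV[R]_(m + 1) := row_mx 0 (const_mx t0).
  have ptE s y : segment_pt (left_part (m:=m)) (right_part (m:=m)) w s y =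
      row_mx (lsubmx y) (const_mx (t0 + s * (rsubmx y 0 0 - t0))).
    rewrite /segment_pt /left_part /right_part /w !scale_row_mx !add_row_mx.
    rewrite !scaler0 !addr0; congr row_mx; apply/matrixP => i j; rewrite !mxE !ord1.
    by ring.
  apply: (@Ck_at_near_eq _ _ _ (segment_moment (left_part (m:=m)) (right_part (m:=m)) w 0 phi)).
    near=> y; rewrite /segment_moment /H /=; congr int01; apply/funext => s.
    by rewrite expr0 mul1r ptE /phi row_mxKl row_mxKr !mxE.
  apply: (Ck_at_segment_moment _ _ Om_open).
  - exact: left_part_continuous.
  - exact: right_part_continuous.
  - move=> z [q cq qz].
    have /asboolP DFs := cinf_smooth (D F).
    have := DFs _ (ex_intro2 _ _ c Ac erefl) (q, rsubmx z 0 0) cq k => /=.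
    rewrite qz (_ : row_mx (lsubmx z) (const_mx (rsubmx z 0 0)) = z)//.
    rewrite -[RHS]hsubmxK; congr row_mx.
    by apply/matrixP => i j; rewrite !ord1 mxE.
  - by move=> s _; rewrite ptE /Om /= row_mxKl row_mxKl; exists p.
exists (Cinf Hs) => p; split=> [|t] /=.
  rewrite /H /= subrr -[RHS]int01_cst; congr int01; apply/funext => s.
  by rewrite mulr0 addr0.
rewrite /H /= -int01Z; last first.
  move=> s _;  exact: time_slice_affine_continuous.
set g := fun s : R => _.
have -> : int01 g = F (p, t0 + 1 * (t - t0)) - F (p, t0 + 0 * (t - t0)); last first.
  by rewrite mul1r mul0r addr0 [t0 + _]addrC subrK addrC subrK.
apply: (@int01_derive _ (fun s => F (p, t0 + s * (t - t0)))).
- move=> s _; apply: continuousM; first exact: cst_continuous.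
  exact: time_slice_affine_continuous.
- move=> s.
  have D1 : is_derive s 1 (fun s : R => t0 + s * (t - t0)) (t - t0).
    apply: is_derive_eq (is_deriveD (is_derive_cst t0 s 1)
      (is_deriveM (is_derive_id s (1:R)) (is_derive_cst (t - t0) s (1:R)))) _.
    by rewrite scaler0 !add0r /GRing.scale /= mulr1.
  have := @is_derive1_comp _ (fun r => F (p, r)) (fun s => t0 + s * (t - t0)) s _ _
    (is_derive_time_slice F p _) D1.
  by move=> H1; apply: is_derive_eq H1 _; rewrite mulrC.
Unshelve. all: by end_near. Qed.

(* The field [X] is only known as a derivation: to differentiate [X (slice F t)]
   in [t], write the difference quotients of [F] in [t] as slices of one smooth
   function, to which [X'] can be applied. *)
Lemma lift_ddt_comm (X : vf A) (X' : vf prod_atlas) (F : cinf prod_atlas) :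
  is_lift X X' -> X' (D F) = D (X' F).
Proof.
move=> hX; apply: cinf_ext => -[p t0].
have [H HP] := hadamard_time F t0.
have sliceE t : slice F t = cinf_cst A (t - t0) * slice H t + slice F t0.
  apply: cinf_ext => q.
  change (F (q, t) = (t - t0) * H (q, t) + F (q, t0)).
  by rewrite addrC; exact: (HP q).2.
have slice0 : slice (D F) t0 = slice H t0.
  by apply: cinf_ext => q; exact/esym/(HP q).1.
have XF t : X' F (p, t) = (t - t0) * X' H (p, t) + X' F (p, t0).
  by rewrite !hX sliceE vf_der.
rewrite hX slice0 -hX hD derive1E; apply/esym.
have L : (fun h : R => h^-1 *: (((fun s => X' F (p, s)) \o shift t0) (h *: (1:R)) - X' F (p, t0)))
    @ 0^' --> X' H (p, t0).
  have C : (fun h : R => X' H (p, t0 + h * 1)) @ 0^' --> X' H (p, t0).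
    have : (fun h : R => X' H (p, t0 + h * 1)) @ (0 : R) --> X' H (p, t0 + 0 * 1).
      exact: (@time_slice_affine_continuous (X' H) p t0 1 0).
    rewrite mul0r addr0; apply: cvg_trans; apply: cvg_app; exact: cvg_within.
  apply: cvg_trans C; apply: near_eq_cvg; near=> h.
  have h0 : h != 0 by near: h; exact: nbhs_dnbhs_neq.
  rewrite /= XF !addrK /GRing.scale /= mulr1 mulKf//.
  by rewrite addrC.
exact: cvg_lim L.
Unshelve. all: by end_near. Qed.

End TimeDerivative.

(** * Orthonormal frames *)

Section Frames.
Variables (R : realType) (M : topologicalType) (m : nat) (A : set (chart R M m)).
Variables (g : vf A -> vf A -> cinf A) (hg : riemannian_metric g).

Lemma cinf_sumE (I : finType) (f : I -> cinf A) q : (\sum_i f i) q = \sum_i f i q.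
Proof. exact: (rmorph_sum (ev q)). Qed.

Definition bilinear_form (B : vf A -> vf A -> cinf A) : Prop :=
  (forall Y, functional (B^~ Y)) /\ (forall X, functional (B X)).

Lemma metric_functional Y : functional (g^~ Y).
Proof. by move=> f X Z; exact: metric_linear hg _ _ _ _. Qed.

(** Subtracting from [X] its expansion at [q], with constant coefficients, leaves a field vanishing
    at [q], which every functional kills there. Applied to [g] against [E j], this identifies the
    coefficients. *)
Lemma tensorial_expand (P : vf A -> Prop) (U : set M) (k : nat) (E : 'I_k -> vf A)
    (q : M) (X : vf A) (L : vf A -> cinf A) :
  orthonormal_frame g P U E -> U q -> tensorial_at A q -> P X -> functional L ->
  L X q = \sum_i g X (E i) q * L (E i) q.
Proof.
move=> [_ EP] Uq tq PX Ll; have [EO /(_ X PX)[a aE]] := EP q Uq.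
have V0 : eq_at q ((-1) *: (\sum_i cinf_cst A (a i) *: E i) + X) 0.
  move=> f; rewrite vf_add vf_scaleE vf_sum.
  change (-1 * (\sum_i cinf_cst A (a i) * E i f) q + X f q = 0).
  by rewrite cinf_sumE aE mulN1r addNr.
have expand L' : functional L' -> L' X q = \sum_i a i * L' (E i) q.
  move=> Ll'; have := tq _ _ Ll' V0.
  rewrite Ll' functional_sum// => E0.
  have : -1 * (\sum_i cinf_cst A (a i) * L' (E i)) q + L' X q = 0 by exact: E0.
  by rewrite cinf_sumE mulN1r addrC => /eqP; rewrite subr_eq0 => /eqP ->.
rewrite (expand L Ll); apply: eq_bigr => j _; congr (_ * _).
rewrite (expand _ (metric_functional (E j))) (bigD1 j)//= EO eqxx mulr1.
rewrite big1 ?addr0// => i ij; by rewrite EO (negPf ij) mulr0.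
Qed.

End Frames.

(** * Normal almost contact metric structures *)

Section AlmostContact.
Variables (R : realType) (M : topologicalType) (m : nat) (A : set (chart R M m)).
Variables (g : vf A -> vf A -> cinf A) (theta : {linear vf A -> vf A}) (xi : vf A)
  (eta : {scalar vf A}).
Hypothesis hacm : almost_contact_metric g theta xi eta.
Local Notation etaC := (eta : vf A -> cinf A).

Lemma cinf_sqr_eq0 (f : cinf A) : f * f = 0 -> f = 0.
Proof.
move=> ff; apply: cinf_ext => p; have : ev p (f * f) = 0 by rewrite ff.
by rewrite rmorphM => /eqP; rewrite mulf_eq0 orbb => /eqP.
Qed.

Lemma cinf_double_eq0 (f : cinf A) : f + f = 0 -> f = 0.
Proof.
move=> ff; apply: cinf_ext => p; have : ev p (f + f) = 0 by rewrite ff.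
by rewrite rmorphD -mulr2n => /eqP; rewrite mulrn_eq0/= => /eqP.
Qed.

Lemma thetaZ f X : theta (f *: X) = f *: theta X.
Proof. exact: linearZ. Qed.

Lemma vfN (X : vf A) f : X (- f) = - X f.
Proof. exact: raddfN. Qed.

(* Stated for the given [theta] and [eta]: the generic lemmas [linearD], ... also
   match the linear map [f *: _] applied to a vector that unfolds to a sum. *)
Lemma thetaD X Y : theta (X + Y) = theta X + theta Y.
Proof. exact: linearD. Qed.

Lemma thetaN X : theta (- X) = - theta X.
Proof. exact: linearN. Qed.

Lemma thetaB X Y : theta (X - Y) = theta X - theta Y.
Proof. exact: linearB. Qed.

Lemma etaN X : etaC (- X) = - etaC X.
Proof. exact: linearN. Qed.

Lemma etaB X Y : etaC (X - Y) = etaC X - etaC Y.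
Proof. exact: linearB. Qed.

Lemma etaZ f X : etaC (f *: X) = f * etaC X.
Proof. exact: linearZ. Qed.

(** Since theta^2 xi = 0, the formula for theta^2 at theta xi makes theta xi a multiple f xi.
    Applying theta again gives f^2 = 0, and C^oo(M) is reduced. *)
Lemma theta_xi : theta xi = 0.
Proof.
have xi2 : theta (theta xi) = 0.
  by rewrite (contact_theta_sq hacm) (contact_eta_xi hacm) scale1r addNr.
have E : theta xi = etaC (theta xi) *: xi.
  apply/eqP; rewrite -subr_eq0 -opprB oppr_eq0 addrC.
  by rewrite -(contact_theta_sq hacm (theta xi)) xi2 linear0.
have : etaC (theta xi) * etaC (theta xi) = 0.
  by rewrite -etaZ -thetaZ -E xi2 linear0.
by move=> e0; rewrite E (cinf_sqr_eq0 e0) scale0r.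
Qed.

(** Compute theta^3 X in two ways. *)
Lemma eta_theta X : etaC (theta X) = 0.
Proof.
have := contact_theta_sq hacm (theta X).
rewrite (contact_theta_sq hacm X) linearD linearN thetaZ theta_xi scaler0 addr0.
move=> /eqP; rewrite -subr_eq0 opprD addrA subrr sub0r oppr_eq0 => /eqP /(congr1 etaC).
by rewrite etaZ (contact_eta_xi hacm) linear0 mulr1.
Qed.

(** * Bracket identities from normality *)

Hypotheses (hM : smooth_manifold A) (hnormal : normal theta xi eta).

Lemma slice_pullback (f : cinf A) t : slice (pullback f) t = f.
Proof. exact: cinf_ext. Qed.

Lemma pullback0 : pullback (0 : cinf A) = 0.
Proof. exact: cinf_ext. Qed.

Lemma pullback1 : pullback (1 : cinf A) = 1.
Proof. exact: cinf_ext. Qed.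

Lemma lift_pullback (X : vf A) (X' : vf (prod_atlas A)) (f : cinf A) p t : is_lift X X' -> X' (pullback f) (p, t) = X f p.
Proof. by move=> ->; rewrite slice_pullback. Qed.

Lemma ddt_pullback (D : vf (prod_atlas A)) (f : cinf A) p t : is_ddt D -> D (pullback f) (p, t) = 0.
Proof. by move=> ->; rewrite /= derive1_cst. Qed.

Lemma lie_lift (X Y : vf A) (X' Y' Z' : vf (prod_atlas A)) : is_lift X X' -> is_lift Y Y' -> is_lift (lie X Y) Z' ->
  lie X' Y' = Z'.
Proof.
move=> hX hY hZ; apply: vf_ext => F; apply: cinf_ext => -[p t].
have E B (B' : vf (prod_atlas A)) (hB : is_lift B B') : slice (B' F) t = B (slice F t).
  by apply: cinf_ext => q; exact: hB.
rewrite hZ; change (X' (Y' F) (p, t) - Y' (X' F) (p, t) = (X (Y (slice F t)) - Y (X (slice F t))) p).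
by rewrite hX hY (E _ _ hX) (E _ _ hY).
Qed.

Lemma lie_lift_ddt (X : vf A) (X' D : vf (prod_atlas A)) : is_lift X X' -> is_ddt D -> lie X' D = 0.
Proof.
move=> hX hD; apply: vf_ext => F.
by change (X' (D F) - D (X' F) = 0); rewrite (lift_ddt_comm hM hD F hX) subrr.
Qed.

(** The M-component of the Nijenhuis tensor on lifts: pulled-back functions kill d/dt, and the
    xi-term of theta^2 cancels the one in [J]. *)
Lemma normal_lie X Y : etaC X = 0 -> etaC Y = 0 ->
  lie (theta X) (theta Y) - theta (lie (theta X) Y) - theta (lie X (theta Y)) - lie X Y = 0.
Proof.
move=> X0 Y0; have [lift [ddt [J [hl hd hJ hN]]]] := hnormal.
have Jl Z : J (lift Z) = lift (theta Z) + pullback (etaC Z) *: ddt.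
  by have := hJ Z 0; rewrite !scale0r addr0 subr0.
have Jl0 Z : etaC Z = 0 -> J (lift Z) = lift (theta Z).
  by move=> Z0; rewrite Jl Z0 pullback0 scale0r addr0.
have ll B C : lie (lift B) (lift C) = lift (lie B C) by exact: lie_lift.
apply: vf_ext => f; apply: cinf_ext => p.
have := congr1 (fun V : vf (prod_atlas A) => V (pullback f) (p, 0)) (hN (lift X) (lift Y)).
rewrite /nijenhuis !Jl0// !ll !Jl hJ.
rewrite !(vf_add, vf_opp, vf_scaleE) /=.
change (lift (lie (theta X) (theta Y)) (pullback f) (p, 0)
  - (lift (theta (lie (theta X) Y)) (pullback f) (p, 0)
     + etaC (lie (theta X) Y) p * ddt (pullback f) (p, 0))
  - (lift (theta (lie X (theta Y))) (pullback f) (p, 0)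
     + etaC (lie X (theta Y)) p * ddt (pullback f) (p, 0))
  + (lift (theta (theta (lie X Y))) (pullback f) (p, 0)
     - etaC (lie X Y) p * lift xi (pullback f) (p, 0)
     + etaC (theta (lie X Y)) p * ddt (pullback f) (p, 0)) = 0 ->
  lie (theta X) (theta Y) f p - theta (lie (theta X) Y) f p
  - theta (lie X (theta Y)) f p - lie X Y f p = 0).
rewrite !(ddt_pullback _ _ _ hd) !(lift_pullback _ _ _ (hl _)) (contact_theta_sq hacm).
change (lie (theta X) (theta Y) f p
  - (theta (lie (theta X) Y) f p + etaC (lie (theta X) Y) p * 0)
  - (theta (lie X (theta Y)) f p + etaC (lie X (theta Y)) p * 0)
  + (- lie X Y f p + etaC (lie X Y) p * xi f p - etaC (lie X Y) p * xi f p
     + etaC (theta (lie X Y)) p * 0) = 0 ->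
  lie (theta X) (theta Y) f p - theta (lie (theta X) Y) f p
  - theta (lie X (theta Y)) f p - lie X Y f p = 0).
by rewrite !mulr0 !addr0 addrK.
Qed.

(** [J] sends the lift of [xi] to d/dt, which commutes with lifts, so two of the four terms of the
    Nijenhuis tensor drop out. *)
Lemma normal_lie_xi X : etaC X = 0 -> theta (lie (theta X) xi) = - lie X xi.
Proof.
move=> X0; have [lift [ddt [J [hl hd hJ hN]]]] := hnormal.
have Jl Z : J (lift Z) = lift (theta Z) + pullback (etaC Z) *: ddt.
  by have := hJ Z 0; rewrite !scale0r addr0 subr0.
have Jl0 Z : etaC Z = 0 -> J (lift Z) = lift (theta Z).
  by move=> Z0; rewrite Jl Z0 pullback0 scale0r addr0.
have lift0 : lift 0 = 0.
  by apply: vf_ext => F; apply: cinf_ext => -[p t]; rewrite hl.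
have Jxi : J (lift xi) = ddt.
  by rewrite Jl theta_xi lift0 (contact_eta_xi hacm) pullback1 scale1r add0r.
have ll B C : lie (lift B) (lift C) = lift (lie B C) by exact: lie_lift.
have ld B : lie (lift B) ddt = 0 by exact: lie_lift_ddt.
apply/esym/eqP; rewrite eq_sym -addr_eq0; apply/eqP.
apply: vf_ext => f; apply: cinf_ext => p.
have := congr1 (fun V : vf (prod_atlas A) => V (pullback f) (p, 0)) (hN (lift X) (lift xi)).
rewrite /nijenhuis Jxi !Jl0// !ll !ld linear0 subr0 sub0r !Jl hJ.
change (- (lift (theta (lie (theta X) xi)) (pullback f) (p, 0)
     + etaC (lie (theta X) xi) p * ddt (pullback f) (p, 0))
  + (lift (theta (theta (lie X xi))) (pullback f) (p, 0)
     - etaC (lie X xi) p * lift xi (pullback f) (p, 0)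
     + etaC (theta (lie X xi)) p * ddt (pullback f) (p, 0)) = 0 ->
  theta (lie (theta X) xi) f p + lie X xi f p = 0).
rewrite !(ddt_pullback _ _ _ hd) !(lift_pullback _ _ _ (hl _)) (contact_theta_sq hacm).
change (- (theta (lie (theta X) xi) f p + etaC (lie (theta X) xi) p * 0)
  + (- lie X xi f p + etaC (lie X xi) p * xi f p - etaC (lie X xi) p * xi f p
     + etaC (theta (lie X xi)) p * 0) = 0 ->
  theta (lie (theta X) xi) f p + lie X xi f p = 0).
by rewrite !mulr0 !addr0 addrK -opprD => /eqP; rewrite oppr_eq0 => /eqP.
Qed.

Lemma normal_eta_lie_xi X : etaC X = 0 -> etaC (lie X xi) = 0.
Proof.
move=> X0; have /(congr1 etaC) := normal_lie_xi X0.
by rewrite eta_theta linearN => /esym/eqP; rewrite oppr_eq0 => /eqP.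
Qed.

(** This is L_xi theta = 0 on the kernel of eta, obtained by applying theta to [normal_lie_xi]. *)
Lemma normal_theta_lie_xi X : etaC X = 0 -> lie (theta X) xi = theta (lie X xi).
Proof.
move=> X0; have /(congr1 theta) := normal_lie_xi X0.
rewrite (contact_theta_sq hacm) (normal_eta_lie_xi (eta_theta X)) scale0r addr0 linearN.
exact: oppr_inj.
Qed.

(** * The horizontal connection and the derivative of theta *)

Variable nabla : vf A -> vf A -> vf A.
Hypotheses (hg : riemannian_metric g) (hLC : levi_civita g nabla).
Local Notation hor := (horizontal g xi).
Local Notation hpr := (hproj g xi).
Local Notation D := (hnabla g nabla xi).
Local Notation S X := (hnabla_end g nabla xi X theta).
Local Notation T X Y := (hnabla2_end g nabla xi X Y theta).

(* The vectors [hnabla _ _ _ X Y] and [hproj _ _ X] are themselves sums up to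
   conversion: they are generalized so that rewriting does not expand them. *)
Ltac vf_ring :=
  repeat match goal with
  | |- context [hnabla2_end ?g ?n ?x ?X ?Y ?B ?Z] => generalize (hnabla2_end g n x X Y B Z)
  end;
  repeat match goal with
  | |- context [hnabla_end ?g ?n ?x ?X ?B ?Y] => generalize (hnabla_end g n x X B Y)
  end;
  repeat match goal with
  | |- context [hnabla ?g ?n ?x ?X ?Y] => generalize (hnabla g n x X Y)
  end;
  repeat match goal with
  | |- context [hproj ?g ?x ?X] => generalize (hproj g x X)
  end;
  intros; rewrite ?(thetaD, thetaN, thetaZ); apply: vf_ext => ?;
  rewrite ?(vf_add, vf_opp, vf_scaleE); ring.

Lemma gDl X Y Z : g (X + Y) Z = g X Z + g Y Z.
Proof. by rewrite -{1}(scale1r X) (metric_linear hg) mul1r. Qed.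

Lemma g0l Z : g 0 Z = 0.
Proof. by have /eqP := gDl 0 0 Z; rewrite addr0 -subr_eq0 opprD addNKr oppr_eq0 => /eqP. Qed.

Lemma gZl f X Z : g (f *: X) Z = f * g X Z.
Proof. by rewrite -[f *: X]addr0 (metric_linear hg) g0l addr0. Qed.

Lemma gNl X Z : g (- X) Z = - g X Z.
Proof. by rewrite -scaleN1r gZl mulN1r. Qed.

Lemma gBl X Y Z : g (X - Y) Z = g X Z - g Y Z.
Proof. by rewrite gDl gNl. Qed.

Lemma gC X Y : g X Y = g Y X.
Proof. exact: Defs.metric_sym hg _ _. Qed.

Lemma gNr X Z : g X (- Z) = - g X Z.
Proof. by rewrite gC gNl gC. Qed.

Lemma metric_eq0 X : g X X = 0 -> X = 0.
Proof.
move=> X0; apply: vf_ext => f; apply: cinf_ext => p; move: f.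
apply: contrapT => /(metric_pos hg); rewrite X0.
by change ((0:R) < 0 -> False); rewrite ltxx.
Qed.

(** Compatibility of [g] with theta, taken against [xi], where theta vanishes. Horizontal fields are
    thus those in the kernel of eta. *)
Lemma etaE X : etaC X = g X xi.
Proof.
have := contact_compatible hacm X xi.
rewrite theta_xi gC g0l (contact_eta_xi hacm) mulr1.
by move=> /esym/eqP; rewrite subr_eq0 => /eqP.
Qed.

Lemma hor_eta X : hor X -> etaC X = 0.
Proof. by rewrite etaE. Qed.

Lemma g_xi_xi : g xi xi = 1.
Proof. by rewrite -etaE (contact_eta_xi hacm). Qed.

Lemma theta_sq X : theta (theta X) = - hpr X.
Proof. by rewrite (contact_theta_sq hacm) /hproj opprB etaE addrC. Qed.

Lemma hor_hproj X : hor (hpr X).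
Proof. by rewrite /horizontal /hproj gBl gZl g_xi_xi mulr1 subrr. Qed.

Lemma hproj_hor X : hor X -> hpr X = X.
Proof. by move=> hX; rewrite /hproj hX scale0r subr0. Qed.

Lemma hor_theta X : hor (theta X).
Proof. by rewrite /horizontal -etaE eta_theta. Qed.

Lemma theta_sq_hor X : hor X -> theta (theta X) = - X.
Proof. by move=> hX; rewrite theta_sq hproj_hor. Qed.

Lemma theta_hproj X : theta (hpr X) = theta X.
Proof.
by rewrite /hproj thetaB thetaZ theta_xi scaler0 subr0.
Qed.

Lemma g_theta X Y : g (theta X) Y = - g X (theta Y).
Proof.
have := contact_compatible hacm X (theta Y).
rewrite eta_theta mulr0 subr0 (contact_theta_sq hacm) gC gDl gNl gZl.
by rewrite [g xi _]gC hor_theta mulr0 addr0 gC => <-; rewrite opprK.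
Qed.

Lemma g_hproj X Z : hor Z -> g (hpr X) Z = g X Z.
Proof. by move=> hZ; rewrite /hproj gBl gZl [g xi Z]gC hZ mulr0 subr0. Qed.

Lemma hproj_linear f X Y : hpr (f *: X + Y) = f *: hpr X + hpr Y.
Proof.
rewrite /hproj gDl gZl scalerDl scalerBr scalerA.
by vf_ring.
Qed.

Lemma nabla_linl f X Y Z : nabla (f *: X + Y) Z = f *: nabla X Z + nabla Y Z.
Proof. exact: (connection_linear hLC). Qed.

Lemma D_linl f X Y Z : D (f *: X + Y) Z = f *: D X Z + D Y Z.
Proof. by rewrite /hnabla nabla_linl hproj_linear. Qed.

Lemma DDr X Y Z : D X (Y + Z) = D X Y + D X Z.
Proof.
rewrite /hnabla (connection_additive hLC) -[nabla X Y]scale1r hproj_linear.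
by rewrite !scale1r.
Qed.

Lemma D0r X : D X 0 = 0.
Proof. by have /eqP := DDr X 0 0; rewrite addr0 -subr_eq0 opprD addNKr oppr_eq0 => /eqP. Qed.

Lemma DNr X Y : D X (- Y) = - D X Y.
Proof. by apply/eqP; rewrite -addr_eq0 -DDr addNr D0r. Qed.

Lemma DBr X Y Z : D X (Y - Z) = D X Y - D X Z.
Proof. by rewrite DDr DNr. Qed.

Lemma D_leibniz f X Y : D X (f *: Y) = X f *: hpr Y + f *: D X Y.
Proof.
rewrite /hnabla (connection_leibniz hLC) hproj_linear -[f *: nabla X Y]addr0.
rewrite hproj_linear; congr (_ + _).
by rewrite -[RHS]addr0; congr (_ + _); rewrite /hproj g0l scale0r subr0.
Qed.

Lemma hor_D X Y : hor (D X Y).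
Proof. exact: hor_hproj. Qed.

Lemma horD X Y : hor X -> hor Y -> hor (X + Y).
Proof. by rewrite /horizontal gDl => -> ->; rewrite addr0. Qed.

Lemma horN X : hor X -> hor (- X).
Proof. by rewrite /horizontal gNl => ->; rewrite oppr0. Qed.

Lemma SE X Y : S X Y = D X (theta Y) - theta (D X Y).
Proof. by []. Qed.

Lemma TE X Y Z : T X Y Z = D X (S Y Z) - S Y (D X Z) - S (nabla X Y) Z.
Proof. by []. Qed.

Lemma DE X Y : D X Y = hpr (nabla X Y).
Proof. by []. Qed.

Lemma hprojE X : hpr X = X - g X xi *: xi.
Proof. by []. Qed.

Lemma comm_hcurvE X Y Z : comm (hcurv g nabla xi X Y) theta Z =
  (D X (D Y (theta Z)) - D Y (D X (theta Z)) - D (lie X Y) (theta Z))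
  - theta (D X (D Y Z) - D Y (D X Z) - D (lie X Y) Z).
Proof. by []. Qed.

Lemma hor_S X Y : hor (S X Y).
Proof. by rewrite SE; apply: horD; [exact: hor_D|apply: horN; exact: hor_theta]. Qed.

Lemma S_linl f X Y Z : S (f *: X + Y) Z = f *: S X Z + S Y Z.
Proof.
rewrite !SE !D_linl; vf_ring.
Qed.

Lemma SDl X Y Z : S (X + Y) Z = S X Z + S Y Z.
Proof. by rewrite -{1}(scale1r X) S_linl scale1r. Qed.

Lemma S0l Z : S 0 Z = 0.
Proof. by have /eqP := SDl 0 0 Z; rewrite addr0 -subr_eq0 opprD addNKr oppr_eq0 => /eqP. Qed.

Lemma SZl f X Z : S (f *: X) Z = f *: S X Z.
Proof. by rewrite -[f *: X]addr0 S_linl S0l addr0. Qed.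

Lemma S_linr f X Y Z : hor Y -> S X (f *: Y + Z) = f *: S X Y + S X Z.
Proof.
move=> hY; rewrite !SE thetaD thetaZ !DDr !D_leibniz.
rewrite !hproj_hor//; last exact: hor_theta.
vf_ring.
Qed.

(** Differentiate theta^2 = -1 on the horizontal bundle. *)
Lemma S_theta X Z : hor Z -> S X (theta Z) = - theta (S X Z).
Proof.
move=> hZ; rewrite !SE theta_sq_hor// DNr.
have -> : theta (D X (theta Z) - theta (D X Z)) = theta (D X (theta Z)) + D X Z.
  by rewrite thetaB theta_sq hproj_hor ?opprK//; exact: hor_D.
vf_ring.
Qed.

Lemma g_S X Y Z : hor Z ->
  g (S X Y) Z = g (nabla X (theta Y)) Z + g (nabla X Y) (theta Z).
Proof.
move=> hZ; rewrite SE gBl !DE g_hproj// theta_hproj g_theta opprK.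
by [].
Qed.

(** Differentiate the skewness of theta, [g_theta], along [X]. *)
Lemma S_skew X Y Z : hor Y -> hor Z -> g (S X Y) Z = - g (S X Z) Y.
Proof.
move=> hY hZ; rewrite !g_S//.
have := connection_metric hLC X (theta Y) Z.
rewrite g_theta vfN (connection_metric hLC) [g Y (nabla _ _)]gC => E.
have -> : g (nabla X (theta Y)) Z = - (g (nabla X Y) (theta Z) + g (nabla X (theta Z)) Y)
   - g (theta Y) (nabla X Z) by rewrite E addrK.
rewrite [g (theta Y) _]gC; ring.
Qed.

(** * Normality in terms of the covariant derivative *)

Lemma lieE X Y : lie X Y = nabla X Y - nabla Y X.
Proof. by rewrite (connection_torsion_free hLC). Qed.

Lemma normal_eta_lie X Y : hor X -> hor Y -> etaC (lie (theta X) (theta Y)) = etaC (lie X Y).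
Proof.
move=> /hor_eta X0 /hor_eta Y0.
have /(congr1 etaC) := normal_lie X0 Y0.
rewrite !etaB linear0 !eta_theta !subr0.
by move=> /eqP; rewrite subr_eq0 => /eqP.
Qed.

(** Invariance of d eta under theta, applied to [X] and [theta Y]; it makes d eta(theta X, Y)
    symmetric in [X] and [Y]. *)
Lemma normal_eta_lie_theta X Y : hor X -> hor Y ->
  etaC (lie (theta X) Y) + etaC (lie X (theta Y)) = 0.
Proof.
move=> hX hY; rewrite -(normal_eta_lie hX (hor_theta Y)) theta_sq_hor//.
have -> : lie (theta X) (- Y) = - lie (theta X) Y.
  apply: vf_ext => f.
  change (theta X ((- Y) f) - (- Y) (theta X f) = - (theta X (Y f) - Y (theta X f))).
  by rewrite !vf_opp vfN; ring.
by rewrite etaN addrN.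
Qed.

(* [g (S (theta X) Y - theta (S X Y)) Z] is symmetric in [X], [Y] by normality
   and skew in [Y], [Z] because each [S X] is skew; such a form vanishes. *)
Lemma S_theta_hor X Y : hor X -> hor Y -> S (theta X) Y = theta (S X Y).
Proof.
pose a X Y Z := g (S (theta X) Y) Z + g (S X Y) (theta Z).
have a_skew X' Y' Z' : hor Y' -> hor Z' -> a X' Y' Z' = - a X' Z' Y'.
  move=> hY hZ; rewrite /a S_skew// [g (S X' Y') _]S_skew//; last exact: hor_theta.
  rewrite S_theta// gNl g_theta opprK; ring.
have a_sym X' Y' Z' : hor X' -> hor Y' -> hor Z' -> a X' Y' Z' = a Y' X' Z'.
  move=> hX hY hZ; rewrite /a !g_S ?theta_sq_hor//; [|exact: hor_theta..].
  have /(congr1 (g^~ Z')) := normal_lie (hor_eta hX) (hor_eta hY).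
  rewrite !gBl g0l !g_theta !opprK !lieE !gBl !gNr => E.
  by apply/eqP; rewrite -subr_eq0; apply/eqP; rewrite -[RHS]E; ring.
move=> hX hY; apply/eqP; rewrite -subr_eq0; apply/eqP.
set V := _ - _.
have hV : hor V by apply: horD; [exact: hor_S|apply: horN; exact: hor_theta].
apply: metric_eq0.
have aV Z : hor Z -> g V Z = a X Y Z by move=> hZ; rewrite /V gBl g_theta opprK.
rewrite aV//; apply: cinf_double_eq0.
(* The skew and the symmetric transposition, alternated three times each, restore the arguments and
   reverse the sign. *)
rewrite {1}a_skew// a_sym// a_skew// opprK a_sym// a_skew// a_sym//.
by rewrite addNr.
Qed.

Lemma g_nabla_xi X Z : hor Z -> g (nabla X xi) Z = - etaC (nabla X Z).
Proof.
move=> hZ; have := connection_metric hLC X xi Z.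
rewrite [g xi Z]gC hZ raddf0 [g xi _]gC -etaE => /esym/eqP.
by rewrite addr_eq0 => /eqP.
Qed.

(* [g (S xi Y) Z] is skew in [Y], [Z], while [L_xi theta = 0] makes it symmetric. *)
Lemma S_xi Y : hor Y -> S xi Y = 0.
Proof.
pose c Y Z := g (nabla (theta Y) xi) Z + g (nabla Y xi) (theta Z).
have cE Y' Z' : hor Y' -> hor Z' -> g (S xi Y') Z' = c Y' Z'.
  move=> hY hZ; rewrite g_S// /c.
  have /(congr1 (g^~ Z')) := normal_theta_lie_xi (hor_eta hY).
  rewrite g_theta !lieE !gBl => /eqP; rewrite subr_eq => /eqP ->; ring.
have c_sym Y' Z' : hor Y' -> hor Z' -> c Y' Z' = c Z' Y'.
  move=> hY hZ; rewrite /c !g_nabla_xi//; [|exact: hor_theta..].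
  have := normal_eta_lie_theta hY hZ; rewrite !lieE !etaB => E.
  by apply/eqP; rewrite -subr_eq0; apply/eqP; rewrite -[RHS]oppr0 -[in RHS]E; ring.
move=> hY; apply: metric_eq0; apply: cinf_double_eq0.
have hS : hor (S xi Y) by exact: hor_S.
by rewrite {1}S_skew// !cE// c_sym// addNr.
Qed.

(** Unit length of [xi] kills the xi-component, so V = nabla_xi xi is horizontal. Then g(V, V) = -
    eta(nabla_xi V), which [normal_eta_lie_xi] turns into - eta(nabla_V xi) = 0. *)
Lemma nabla_xi_xi : nabla xi xi = 0.
Proof.
have hxx : g (nabla xi xi) xi = 0.
  apply: cinf_double_eq0; have := connection_metric hLC xi xi xi.
  by rewrite g_xi_xi vf1 [g xi _]gC => <-.
apply: metric_eq0; have hV : hor (nabla xi xi) by [].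
set V := nabla xi xi in hV *.
have := normal_eta_lie_xi (hor_eta hV).
rewrite lieE etaB g_nabla_xi// => /eqP; rewrite subr_eq0 => /eqP <-.
rewrite etaE; apply/eqP; rewrite oppr_eq0; apply/eqP.
apply: cinf_double_eq0; have := connection_metric hLC V xi xi.
by rewrite g_xi_xi vf1 [g xi _]gC => <-.
Qed.

Lemma S_hproj X Z : hor Z -> S (hpr X) Z = S X Z.
Proof.
move=> hZ; rewrite hprojE addrC -scaleNr S_linl S_xi// scaler0 add0r.
by [].
Qed.

(** Both sides see only the horizontal part of [X], because theta xi = 0 and S_xi = 0. *)
Lemma S_thetal X Z : hor Z -> S (theta X) Z = theta (S X Z).
Proof.
by move=> hZ; rewrite -theta_hproj S_theta_hor// ?S_hproj//; exact: hor_hproj.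
Qed.

(** * The second covariant derivative of theta *)

Lemma ricci_identity X Y Z :
  comm (hcurv g nabla xi X Y) theta Z = T X Y Z - T Y X Z.
Proof.
rewrite !TE comm_hcurvE.
have -> : S (nabla X Y) Z = S (lie X Y) Z + S (nabla Y X) Z.
  by rewrite -SDl lieE subrK.
rewrite !SE !DBr; vf_ring.
Qed.

(** The derivative of S_(theta Y) = theta S_Y. The term [S (S X Y) Z] arises because the horizontal
    part of [nabla X (theta Y)] is [S X Y + theta (nabla X Y)]. *)
Lemma hnabla2_thetar X Y Z : hor Z ->
  T X (theta Y) Z = S X (S Y Z) + theta (T X Y Z) - S (S X Y) Z.
Proof.
move=> hZ; rewrite !TE.
rewrite -[S (nabla X (theta Y)) Z]S_hproj//.
have -> : hpr (nabla X (theta Y)) = S X Y + theta (nabla X Y).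
  by rewrite SE !DE theta_hproj subrK.
rewrite SDl !S_thetal//; last exact: hor_D.
have -> : D X (theta (S Y Z)) = S X (S Y Z) + theta (D X (S Y Z)) by rewrite [S X _]SE subrK.
vf_ring.
Qed.

Lemma hnabla2_comm_theta X Y Z : hor Z ->
  T X Y (theta Z) = - theta (T X Y Z) - S X (S Y Z) - S Y (S X Z).
Proof.
move=> hZ; rewrite !TE !S_theta//; first last.
have DthE W : D X (theta W) = S X W + theta (D X W) by rewrite [S X W]SE subrK.
rewrite DthE.
have hS : hor (S X Z) by exact: hor_S.
have -> : S Y (S X Z + theta (D X Z)) = S Y (S X Z) + S Y (theta (D X Z)).
  by rewrite -{1}(scale1r (S X Z)) S_linr// scale1r.
rewrite DNr DthE S_theta; last exact: hor_D.
vf_ring.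
Qed.

(** S_xi vanishes and [xi] is geodesic. This reduces traces over TM to the horizontal bundle. *)
Lemma hnabla2_xi_xi Z : hor Z -> T xi xi Z = 0.
Proof.
move=> hZ; rewrite TE nabla_xi_xi S0l !S_xi//; last exact: hor_D.
by rewrite D0r !subr0.
Qed.

Lemma hnabla2_linl f X X' Y Z : hor Z -> T (f *: X + X') Y Z = f *: T X Y Z + T X' Y Z.
Proof.
move=> hZ; rewrite !TE !D_linl nabla_linl S_linl S_linr; last exact: hor_D.
vf_ring.
Qed.

Lemma hnabla2_linr f X Y Y' Z : hor Z -> T X (f *: Y + Y') Z = f *: T X Y Z + T X Y' Z.
Proof.
move=> hZ; rewrite !TE !S_linl DDr D_leibniz hproj_hor; last exact: hor_S.
rewrite (connection_additive hLC) (connection_leibniz hLC) SDl S_linl.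
rewrite SZl; vf_ring.
Qed.

(** * Frames, traces and the curvature identity *)

Variables (k : nat) (U : set M) (F : 'I_k -> vf A).
Hypothesis hF : orthonormal_frame g (horizontal g xi) U F.

Definition adapted_frame (i : 'I_k.+1) : vf A :=
  if unlift ord_max i is Some j then F j else xi.


Lemma adapted_frame_orthonormal :
  orthonormal_frame g (fun=> True) U adapted_frame.
Proof.
split=> // p Up; have [Fhor FP] := hF; have [FO Fspan] := FP p Up.
split=> [i j|X _].
  rewrite /adapted_frame.
  case: (unliftP ord_max i) => [i'|] ->; case: (unliftP ord_max j) => [j'|] ->.
  - by rewrite FO (inj_eq (lift_inj)).
  - by rewrite Fhor eq_sym (negPf (neq_lift _ _)).
  - by rewrite gC Fhor (negPf (neq_lift _ _)).
  - by rewrite g_xi_xi eqxx.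
have [a aE] := Fspan _ (hor_hproj X).
exists (fun i => if unlift ord_max i is Some j then a j else g X xi p) => f.
rewrite big_ord_recr /= {2}/adapted_frame unlift_none.
have -> : X f p = hproj g xi X f p + g X xi p * xi f p.
  change (X f p = X f p - g X xi p * xi f p + g X xi p * xi f p).
  by rewrite subrK.
rewrite aE; congr (_ + _); apply: eq_bigr => i _.
have -> : widen_ord (leqnSn k) i = lift ord_max i by apply: val_inj; rewrite /= /bump leqNgt ltn_ord.
by rewrite /adapted_frame liftK.
Qed.

Lemma sum_adapted_frame (V : nmodType) (f : vf A -> V) :
  \sum_i f (adapted_frame i) = \sum_j f (F j) + f xi.
Proof.
rewrite big_ord_recr /= {2}/adapted_frame unlift_none; congr (_ + _).
apply: eq_bigr => i _.
have -> : widen_ord (leqnSn k) i = lift ord_max i by apply: val_inj; rewrite /= /bump leqNgt ltn_ord.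
by rewrite /adapted_frame liftK.
Qed.

(** Expand [E i] in the frame [E'] in one argument, exchange the sums, and recognize the expansion
    of [E' j] in the frame [E] in the other. *)
Lemma trace_frame_indep (l l' : nat) (W W' : set M) (E : 'I_l -> vf A) (E' : 'I_l' -> vf A)
    (B : vf A -> vf A -> cinf A) (q : M) :
  orthonormal_frame g (fun=> True) W E -> orthonormal_frame g (fun=> True) W' E' ->
  bilinear_form B -> W q -> W' q -> tensorial_at A q ->
  \sum_i B (E i) (E i) q = \sum_j B (E' j) (E' j) q.
Proof.
move=> hE hE' [Bl Br] Wq W'q tq.
under eq_bigr => i _ do rewrite (tensorial_expand hg hE' W'q tq I (Bl (E i))).
rewrite exchange_big; apply: eq_bigr => j _.
rewrite (tensorial_expand hg hE Wq tq I (Br (E' j))).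
by apply: eq_bigr => i _; rewrite gC.
Qed.

(** The same exchange of sums, with the matrix of theta in the frame [F], which is skew. *)
Lemma trace_theta_skew (B : vf A -> vf A -> cinf A) (q : M) :
  bilinear_form B -> U q -> tensorial_at A q ->
  \sum_i B (theta (F i)) (F i) q = - \sum_i B (F i) (theta (F i)) q.
Proof.
move=> [Bl Br] Uq tq.
under eq_bigr => i _ do
  rewrite (tensorial_expand hg hF Uq tq (hor_theta _) (Bl (F i))).
rewrite exchange_big -sumrN; apply: eq_bigr => j _.
rewrite (tensorial_expand hg hF Uq tq (hor_theta _) (Br (F j))) -sumrN.
apply: eq_bigr => i _; rewrite g_theta gC.
by change (- g (theta (F j)) (F i) q * B (F j) (F i) q = - (g (theta (F j)) (F i) q * B (F j) (F i) q)); rewrite mulNr.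
Qed.

Lemma functional_vf (L : vf A -> vf A) (f : cinf A) :
  (forall h X Y, L (h *: X + Y) = h *: L X + L Y) -> functional (fun X => L X f).
Proof. by move=> Ll h X Y; rewrite Ll. Qed.

(** On the diagonal this is the summand of [nabla^* nabla theta, theta] after theta has been moved
    past [T]. Two separate arguments make it a bilinear form, whose trace is independent of the
    frame. *)
Definition trace_term (Y X X' : vf A) : vf A := (theta (T X X' Y) + S X (S X' Y)) *+ 2.

Lemma trace_term_bilinear (Y : vf A) (f : cinf A) : hor Y ->
  bilinear_form (fun X X' => trace_term Y X X' f).
Proof.
move=> hY; split=> [X'|X]; apply: functional_vf => h X1 X2; rewrite /trace_term.
  rewrite hnabla2_linl// S_linl thetaD thetaZ !mulr2n; vf_ring.
rewrite hnabla2_linr// S_linl S_linr; last exact: hor_S.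
by rewrite thetaD thetaZ !mulr2n; vf_ring.
Qed.

Lemma rough_laplacian_comm (l : nat) (E : 'I_l -> vf A) (Y : vf A) : hor Y ->
  comm (rough_laplacian g nabla xi E theta) theta Y = \sum_i trace_term Y (E i) (E i).
Proof.
move=> hY; rewrite /comm /rough_laplacian thetaN opprK [theta (\sum_i _)]linear_sum.
rewrite -sumrN -big_split; apply: eq_bigr => i _.
change (- T (E i) (E i) (theta Y) + theta (T (E i) (E i) Y) = trace_term Y (E i) (E i)).
by rewrite hnabla2_comm_theta// /trace_term !mulr2n; vf_ring.
Qed.

Lemma S_hdiv (Y : vf A) :
  S (hdiv g nabla xi F theta) Y = \sum_i S (S (F i) (F i)) Y.
Proof.
by rewrite /hdiv; elim/big_rec2: _ => [|i X1 X2 _ <-]; [exact: S0l|exact: SDl].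
Qed.

(** The pointwise form of the main identity, at a point where traces may be computed in any
    orthonormal frame. *)
Lemma identity_at (l : nat) (W : set M) (E : 'I_l -> vf A) (q : M) (Y : vf A) (f : cinf A) :
  orthonormal_frame g (fun=> True) W E -> W q -> U q -> tensorial_at A q -> hor Y ->
  (\sum_i comm (hcurv g nabla xi (F i) (theta (F i))) theta Y) f q =
  (- (S (hdiv g nabla xi F theta) Y *+ 2)
   + comm (rough_laplacian g nabla xi E theta) theta Y) f q.
Proof.
move=> hE Wq Uq tq hY.
have [Bl Br] := trace_term_bilinear f hY.
have T_bil : bilinear_form (fun X X' => T X X' Y f).
  split=> [X'|X]; apply: functional_vf => h X1 X2; first exact: hnabla2_linl.
  exact: hnabla2_linr.
have traceE : (comm (rough_laplacian g nabla xi E theta) theta Y) f q =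
    \sum_i trace_term Y (F i) (F i) f q.
  rewrite rough_laplacian_comm// vf_sum cinf_sumE.
  (* The trace over TM moves to the frame formed by the [F i] and [xi], where the term of [xi]
     vanishes. *)
  rewrite (trace_frame_indep hE adapted_frame_orthonormal (conj Bl Br) Wq Uq tq).
  rewrite (sum_adapted_frame (fun X => trace_term Y X X f q)).
  have -> : trace_term Y xi xi = 0.
    rewrite /trace_term hnabla2_xi_xi// [theta 0]linear0 S_xi; last exact: hor_S.
    by rewrite addr0 mul0rn.
  by rewrite addr0.
(* Skewness makes the second trace in the Ricci identity minus the first, so the curvature sum is
   twice the first. *)
have skew := trace_theta_skew T_bil Uq tq.
rewrite vf_add; change ((\sum_i comm (hcurv g nabla xi (F i) (theta (F i))) theta Y) f q =
  (- (S (hdiv g nabla xi F theta) Y *+ 2)) f q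
  + (comm (rough_laplacian g nabla xi E theta) theta Y) f q).
rewrite traceE -!cinf_sumE -!vf_sum S_hdiv.
have -> : \sum_i comm (hcurv g nabla xi (F i) (theta (F i))) theta Y =
    \sum_i T (F i) (theta (F i)) Y - \sum_i T (theta (F i)) (F i) Y.
  by rewrite -sumrN -big_split; apply: eq_bigr => i _; exact: ricci_identity.
have E2 : (\sum_i T (F i) (theta (F i)) Y) *+ 2 =
    - ((\sum_i S (S (F i) (F i)) Y) *+ 2) + \sum_i trace_term Y (F i) (F i).
  rewrite -sumrMnl -sumrMnl -sumrN -big_split; apply: eq_bigr => i _.
  by rewrite hnabla2_thetar// /trace_term !mulr2n; vf_ring.
change ((\sum_i T (F i) (theta (F i)) Y) f q - (\sum_i T (theta (F i)) (F i) Y) f q =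
  (- ((\sum_i S (S (F i) (F i)) Y) *+ 2) + \sum_i trace_term Y (F i) (F i)) f q).
rewrite -E2 mulr2n.
rewrite [X in _ - X](_ : _ = - (\sum_i T (F i) (theta (F i)) Y) f q) ?opprK//.
by rewrite !vf_sum !cinf_sumE.
Qed.

(* Smooth functions are continuous, so it is enough to check the identity at a
   dense set of points. *)
Lemma curvature_laplacian_identity (l : nat) (W : set M) (E : 'I_l -> vf A) (p : M) (Y : vf A) :
  open U -> open W -> orthonormal_frame g (fun=> True) W E -> W p -> U p -> hor Y ->
  eq_at p (\sum_i comm (hcurv g nabla xi (F i) (theta (F i))) theta Y)
    (- (S (hdiv g nabla xi F theta) Y *+ 2)
     + comm (rough_laplacian g nabla xi E theta) theta Y).
Proof.
move=> oU oW hE Wp Up hY f.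
set V1 := \sum_i _; set V2 := _ + _.
apply/eqP; rewrite -subr_eq0; apply/negPn/negP => V12.
(* If the identity failed at [p], then [G] would be nonzero on an open set; this set contains a
   tensorial point, against [identity_at]. *)
pose G : cinf A := V1 f - V2 f.
have oG : open [set q | G q != 0].
  rewrite (_ : [set _ | _] = G @^-1` [set~ 0]); last by apply/seteqP; split=> q /eqP.
  apply: open_comp => [q _|]; first exact: (cinf_continuous hM).
  by apply: closed_openC; exact: closed_eq.
have [|||q [[Uq Wq] Gq] tq] := tensorial_dense hM (E := adapted_frame)
    (W := (U `&` W) `&` [set q | G q != 0]) (p0 := p).
- by apply: openI => //; exact: openI.
- by split.
- by move=> q [[Uq Wq] _] X; have [_ /(_ q Uq)[_ /(_ X I)]] := adapted_frame_orthonormal.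
move/eqP: Gq; apply; change (V1 f q - V2 f q = 0).
by rewrite (identity_at f hE Wq Uq tq hY) subrr.
Qed.

End AlmostContact.

(** * Equivalence of the harmonic section equation and the curvature equation *)

Theorem theorem3p4 (R : realType) (M : topologicalType) (n : nat)
    (A : set (chart R M (2 * n).+1)) (hM : smooth_manifold A)
    (g : vf A -> vf A -> cinf A) (hg : riemannian_metric g)
    (nabla : vf A -> vf A -> vf A) (hnabla_LC : levi_civita g nabla)
    (theta : {linear vf A -> vf A}) (xi : vf A) (eta : {scalar vf A})
    (hacm : almost_contact_metric g theta xi eta)
    (hnormal : normal theta xi eta) :
  forall (I : Type) (U : I -> set M) (F : I -> 'I_(2 * n) -> vf A),
  (forall a, open (U a)) ->
  (forall a, orthonormal_frame g (horizontal g xi) (U a) (F a)) ->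
  (forall p, exists a, U a p) ->
  first_harmonic_section_equation g nabla theta xi <->
  (forall a Y p, horizontal g xi Y -> U a p ->
   eq_at p
     (\sum_i comm (hcurv g nabla xi (F a i) (theta (F a i))) theta Y)
     (- (hnabla_end g nabla xi (hdiv g nabla xi (F a) theta) theta Y *+ 2))).
Proof.
move=> I U F oU hF covU; split=> [hse a Y p hY Uap | hR U' E oU' hE Y p hY U'p].
(* Completed by [xi], the horizontal frame has 2n + 1 members and is one of the frames of TM over
   which the harmonic equation quantifies. *)
- have hE := adapted_frame_orthonormal hacm hg (hF a).
  move=> f; rewrite (curvature_laplacian_identity hacm hM hnormal hg hnabla_LC
    (hF a) (oU a) (oU a) hE Uap Uap hY f).
  have := hse _ _ (oU a) hE Y p hY Uap f.
  set V1 := comm _ _ _; set V2 := - _ => V0.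
  by change (V2 f p + V1 f p = V2 f p); rewrite V0; change (V2 f p + 0 = V2 f p); rewrite addr0.
(* The frame [E] of TM and the horizontal frame around [p] are unrelated; the identity compares them
   at their common point [p]. *)
- have [a Uap] := covU p; move=> f.
  have := curvature_laplacian_identity hacm hM hnormal hg hnabla_LC
    (hF a) (oU a) oU' hE U'p Uap hY f.
  rewrite (hR a Y p hY Uap f); set V1 := comm _ _ _; set V2 := - _.
  change (V2 f p = V2 f p + V1 f p -> V1 f p = 0) => /esym/eqP.
  by rewrite -subr_eq0 addrAC subrr add0r => /eqP.
Qed.
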